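(* For each $m\in\mathbb{N}$ and each vector $(\eta_1,\dots,\eta_m)\in[1/2,1]^m$ there exists an SV model with Gamma-type log-volatility $(X_t,\sigma_t)_{t\in\mathbb{Z}}$ such that, for all $1\le h\le m$, the coefficient of tail dependence of $(\sigma_0,\sigma_h)$ and the coefficient of tail dependence of $(X_0,X_h)$ both equal $\eta_h$.
   Context: SV model with Gamma-type log-volatility: a stationary process with $X_t=\sigma_t\varepsilon_t$, $t\in\mathbb{Z}$, where $\varepsilon_t$, $t\in\mathbb{Z}$, are i.i.d. with $P(\varepsilon_0>0)>0$ and $E(|\varepsilon_0|^{1+\delta})<\infty$ for some $\delta>0$, and $\log\sigma_t=\sum_{i=0}^\infty\alpha_i\xi_{t-i}$, $t\in\mathbb{Z}$, with (a) coefficients $\alpha_i\in[0,1]$, $i\in\mathbb{N}_0$, such that $\max_{i\in\mathbb{N}_0}\alpha_i=1$ and $\alpha_i=O(i^{-\theta})$ as $i\to\infty$ for some $\theta>1$; (b) i.i.d. random variables $\xi_t$, $t\in\mathbb{Z}$, independent of $(\varepsilon_t)_{t\in\mathbb{Z}}$, with $E(\xi_0^2)<\infty$ and $P(\xi_0>z)\sim Kz^\beta e^{-z}$ as $z\to\infty$, for a real constant $\beta\ne-1$ and a constant $K>0$. Coefficient of tail dependence: a bivariate random vector $(Y_0,Y_1)$ whose components have the same marginal quantile function $F^{\leftarrow}$ has coefficient of tail dependence $\eta$ if the function $x\mapsto P\bigl(Y_0>F^{\leftarrow}(1-1/x),\,Y_1>F^{\leftarrow}(1-1/x)\bigr)$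 is regularly varying (at infinity) with index $-1/\eta$. *)

(* Defs.v *)
From HB Require Import structures.
From mathcomp Require Import all_boot all_order all_algebra.
From mathcomp Require Import all_classical all_reals all_analysis.

Set Implicit Arguments.
Unset Strict Implicit.
Unset Printing Implicit Defensive.
Import Order.TTheory GRing.Theory Num.Theory.
Import numFieldNormedType.Exports.
Local Open Scope classical_set_scope.
Local Open Scope ring_scope.

Section Processes.
Context d (T : measurableType d) (R : realType) (P : probability T R).
Implicit Types (X Y Z : int -> {RV P >-> R}).

Definition mutually_independent Z : Prop :=
  forall (s : seq int) (A : int -> set R), uniq s ->
    (forall t, measurable (A t)) ->
    P (\big[setI/setT]_(t <- s) (Z t @^-1` A t)) =
    (\prod_(t <- s) P (Z t @^-1` A t))%E.

Definition identically_distributed Z : Prop :=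
  forall (t : int) (A : set R), measurable A ->
    distribution P (Z t) A = distribution P (Z 0) A.

Definition iid Z : Prop := mutually_independent Z /\ identically_distributed Z.

Definition sigma_of Z : set (set T) :=
  <<s \bigcup_(t : int) preimage_set_system setT (Z t) measurable >>.

Definition independent_processes Y Z : Prop :=
  forall A B : set T, sigma_of Y A -> sigma_of Z B ->
    P (A `&` B) = (P A * P B)%E.

Definition jointly_stationary Y Z : Prop :=
  forall (n : nat) (t : 'I_n -> int) (k : int) (B : set (n.-tuple (R * R)%type)),
    measurable B ->
    P [set w | B [tuple (Y (t i + k) w, Z (t i + k) w) | i < n]] =
    P [set w | B [tuple (Y (t i) w, Z (t i) w) | i < n]].

End Processes.

Section TailDependence.
Context (R : realType).

Definition regularly_varying (f : R -> R) (rho : R) : Prop :=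
  (exists a : R, measurable_fun `]a, +oo[ f /\ forall x, a < x -> 0 < f x) /\
  forall lam : R, 0 < lam -> f (lam * x) / f x @[x --> +oo] --> lam `^ rho.

Context d (T : measurableType d) (P : probability T R).

(* The infimum is taken in [\bar R] because it is infinite for some [p]
   outside ]0, 1[. *)
Definition quantile (Y : {RV P >-> R}) (p : R) : \bar R :=
  ereal_inf [set y%:E | y in [set y : R | (p%:E <= cdf Y y)%E]].

Definition joint_exceedance (Y0 Y1 : {RV P >-> R}) (x : R) : R :=
  fine (P [set w | (quantile Y0 (1 - x^-1) < (Y0 w)%:E)%E /\
                   (quantile Y1 (1 - x^-1) < (Y1 w)%:E)%E]).

(* [eta != 0] keeps [- eta^-1] meaningful, since [0^-1 = 0]. *)
Definition coef_tail_dependence (Y0 Y1 : {RV P >-> R}) (eta : R) : Prop :=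
  [/\ forall p : R, 0 < p < 1 -> quantile Y0 p = quantile Y1 p,
      eta != 0
    & regularly_varying (joint_exceedance Y0 Y1) (- eta^-1)].

End TailDependence.

Section SVModel.
Context d (T : measurableType d) (R : realType) (P : probability T R).

Definition gamma_coefficients (alpha : nat -> R) : Prop :=
  [/\ forall i, 0 <= alpha i <= 1,
      exists i, alpha i = 1
    & exists theta : R, 1 < theta /\
        alpha =O_\oo (fun i : nat => i%:R `^ (- theta))].

Definition gamma_innovations (xi : int -> {RV P >-> R}) : Prop :=
  [/\ iid xi,
      ('E_P[fun w => (xi 0 w ^+ 2)%R] < +oo)%E
    & exists beta K : R, [/\ beta != -1, 0 < K &
        fine (ccdf (xi 0) z) / (K * z `^ beta * expR (- z)) @[z --> +oo]
          --> (1 : R)]].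

Definition multiplicative_noise (eps : int -> {RV P >-> R}) : Prop :=
  [/\ iid eps,
      (0 < P [set w | (0 < eps 0 w)%R])%E
    & exists delta : R, 0 < delta /\
        ('E_P[fun w => (`|eps 0 w| `^ (1 + delta))%R] < +oo)%E].

(* The series defining [log sigma_t] converges only almost surely. *)
Definition gamma_SV_model (X sigma : int -> {RV P >-> R}) : Prop :=
  jointly_stationary X sigma /\
  exists (eps xi : int -> {RV P >-> R}) (alpha : nat -> R),
  [/\ multiplicative_noise eps /\ (forall t w, X t w = sigma t w * eps t w),
      gamma_coefficients alpha,
      gamma_innovations xi,
      independent_processes xi eps
    & (forall t w, 0 < sigma t w) /\
      forall t : int, {ae P, forall w,
        series (fun i : nat => alpha i * xi (t - i%:Z) w) @ \oo
          --> ln (sigma t w)}].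

End SVModel.

(* Main.v *)
(* Idea: the noise is the constant 1, so X = sigma, and log sigma is a moving
   average of finite order of i.i.d. standard exponential variables xi (beta = 0).
   Its coefficients are a_0 = 1 and, for h = 1, ..., m, one block
   a_(h L) = a_(h L + h) = t_h with L = 2 m + 1, where t_h = eta_h if eta_h > 1/2
   and t_h = 0 if eta_h = 1/2.  Blocks are so far apart that log sigma_0 and
   log sigma_h share at most one innovation, with the weight t_h in both.

   For E standard exponential and independent of W,
     e^z P(W + E > z) = E(min(e^z, e^W)) =: M_W(z).
   If E(e^W) is finite, M_W is bounded and nondecreasing; and if
   M_W(z + s) / M_W(z) -> 1, then the same holds for M_(W + E).  Hence
   P(log sigma_0 > z) = e^(-z) M(z) with such an M.  If t = t_h > 1/2, then
   min(log sigma_0, log sigma_h) = t (E + W), where E(e^W) is finite because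
   t W = min(A, B) <= (A + B) / 2 and all weights in (A + B) / (2 t) are < 1; so
   the joint tail at z is e^(-z / t) M_W(z / t).  If t_h = 0, the two variables are
   independent and the joint tail is e^(-2 z) M(z)^2.  Substituting the marginal
   quantile gives regular variation with index -1 / eta_h.

   The i.i.d. sequence lives on [0, 1]: the binary digits of a uniform point are
   i.i.d., they are split into countably many sequences, and each of these is read
   as the expansion of a new uniform variable U, whence xi = - ln U. *)
From HB Require Import structures.
Require Import Defs.
From mathcomp Require Import all_boot all_order all_algebra.
From mathcomp Require Import all_classical all_reals all_analysis measurable_realfun.
From mathcomp Require Import lra ring zify.

Set Implicit Arguments.
Unset Strict Implicit.
Unset Printing Implicit Defensive.
Import Order.TTheory GRing.Theory Num.Theory.
Import numFieldNormedType.Exports.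
Local Open Scope classical_set_scope.
Local Open Scope ring_scope.

(** * Independent families *)

Lemma big_setI_seqP (I : eqType) T (s : seq I) (F : I -> set T) w :
  (\big[setI/setT]_(i <- s) F i) w <-> forall i, i \in s -> F i w.
Proof.
elim: s => [|j s ih]; first by rewrite big_nil.
rewrite big_cons; split.
  by move=> [Fj /ih h] i; rewrite inE => /orP[/eqP ->//|/h].
move=> h; split; first by apply: h; rewrite inE eqxx.
by apply/ih => i si; apply: h; rewrite inE si orbT.
Qed.

(** The pi-lambda theorem; every passage below from cylinders to a generated sigma-algebra goes
    through it. *)
Lemma g_sigma_sub_dynkin T (G D : set (set T)) :
  setI_closed G -> dynkin D -> G `<=` D -> <<s G >> `<=` D.
Proof.
move=> GI dD GD; rewrite -(setI_closed_g_dynkin_g_sigma_algebra GI).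
exact: smallest_sub.
Qed.

Section CoordinateSigmaAlgebra.
Context (R : realType) (T : pointedType) (I : choiceType) (Z : I -> T -> R).

Definition coord_gen (D : set I) : set (set T) :=
  \bigcup_(i in D) preimage_set_system setT (Z i) measurable.

(** Finite cylinders. Unlike [coord_gen], they are closed under intersection, as the pi-lambda
    theorem requires. *)
Definition coord_cyl (D : set I) : set (set T) :=
  [set C | exists (s : seq I) (A : I -> set R),
     [/\ uniq s, [set` s] `<=` D, forall i, measurable (A i) &
         C = \big[setI/setT]_(i <- s) (Z i @^-1` A i)]].

Lemma coord_gen_cyl D : coord_gen D `<=` coord_cyl D.
Proof.
move=> _ [i Di [B mB <-]]; exists [:: i], (fun=> B); split => //.
  by move=> j /=; rewrite inE => /eqP ->.
by rewrite big_seq1 setTI.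
Qed.

Lemma coord_cyl_setT D : coord_cyl D setT.
Proof. by exists [::], (fun=> setT); split => //; rewrite big_nil. Qed.

Lemma coord_cyl_setI D : setI_closed (coord_cyl D).
Proof.
move=> _ _ [s [A [us sD mA ->]]] [s' [A' [us' sD' mA' ->]]].
(* A coordinate that only one of the cylinders constrains receives [setT] from the other; [undup]
   merges the coordinates that both constrain. *)
exists (undup (s ++ s')), (fun i => (if i \in s then A i else setT) `&`
  (if i \in s' then A' i else setT)); split.
- exact: undup_uniq.
- by move=> i /=; rewrite mem_undup mem_cat => /orP[/sD|/sD'].
- by move=> i; apply: measurableI; case: ifP.
apply/seteqP; split => w.
  move=> [/big_setI_seqP h /big_setI_seqP h']; apply/big_setI_seqP => i _.
  by split; case: ifP => // ?; [exact: h|exact: h'].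
move=> /big_setI_seqP h; split; apply/big_setI_seqP => i si.
  by have := h i; rewrite mem_undup mem_cat si => /(_ isT)[].
by have := h i; rewrite mem_undup mem_cat si orbT => /(_ isT)[].
Qed.

Lemma sub_g_sigma_coord_cyl D : <<s coord_gen D >> `<=` <<s coord_cyl D >>.
Proof. by apply: sub_sigma_algebra2; exact: coord_gen_cyl. Qed.

Lemma measurable_coord D i : D i ->
  measurable_fun [set: g_sigma_algebraType (coord_gen D)] (Z i).
Proof.
move=> Di _ B mB; apply: sub_sigma_algebra.
by exists i => //; exists B.
Qed.

End CoordinateSigmaAlgebra.

Section Independence.
Context d (T : measurableType d) (R : realType) (P : probability T R).

(** [mutually_independent] for bare functions and any index type, so that it also covers binary
    digits and innovations counted backwards. *)
Definition independent_family (I : eqType) (Z : I -> T -> R) : Prop :=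
  forall (s : seq I) (A : I -> set R), uniq s ->
    (forall i, measurable (A i)) ->
    P (\big[setI/setT]_(i <- s) (Z i @^-1` A i)) =
    (\prod_(i <- s) P (Z i @^-1` A i))%E.

Definition independent_rv (X Y : T -> R) : Prop :=
  forall A B : set R, measurable A -> measurable B ->
    P (X @^-1` A `&` Y @^-1` B) = (P (X @^-1` A) * P (Y @^-1` B))%E.

Lemma independent_family_inj (I J : eqType) (f : J -> I) (Z : I -> T -> R) :
  injective f -> independent_family Z -> independent_family (Z \o f).
Proof.
move=> fI ZI s A us mA.
have [s0|[j0 sj0]] : s = [::] \/ exists j, j \in s.
- by case: s us => [|j s] _; [left|right; exists j; rewrite inE eqxx].
- by rewrite s0 !big_nil probability_setT.
(* [g] inverts [f] on [s] and carries the sets indexed by [J] over to [I]; its default value [j0] is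
   why the empty list was split off. *)
pose g i := nth j0 s (index i (map f s)).
have gK j : j \in s -> g (f j) = j by move=> js; rewrite /g index_map// nth_index.
have := ZI (map f s) (A \o g).
rewrite map_inj_uniq// => /(_ us (fun=> mA _)).
rewrite !big_map => h; rewrite big_seq [RHS]big_seq.
rewrite (eq_bigr (fun i => Z (f i) @^-1` (A \o g) (f i))); last first.
  by move=> i si /=; rewrite gK.
rewrite -big_seq h big_seq; apply: eq_bigr => i si /=.
by rewrite gK.
Qed.

Lemma dynkin_independent (A : set T) : measurable A ->
  dynkin [set B | measurable B /\ P (A `&` B) = (P A * P B)%E].
Proof.
move=> mA; split => /=.
- by rewrite setIT probability_setT mule1; split.
- move=> B [mB PB]; split; first exact: measurableC.
  have mAB : measurable (A `&` B) by exact: measurableI.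
  rewrite probability_setC// -setDE measureD//; last first.
    by rewrite ltey_eq fin_num_measure.
  rewrite [X in (_ - X)%E](_ : _ = P A * P B)%E; last by rewrite -PB.
  have fA : P A \is a fin_num by exact: fin_num_measure.
  have fB : P B \is a fin_num by exact: fin_num_measure.
  by rewrite muleBr ?mule1// fin_num_adde_defr.
- move=> F tF mF; have mF1 k : measurable (F k) by have [] := mF k.
  split; first exact: bigcupT_measurable.
  rewrite setI_bigcupr !measure_bigcup//=.
  + rewrite -(fineK (fin_num_measure P _ mA)) -nneseriesZl; last by [].
    by apply: eq_eseriesr => k _; rewrite fineK ?fin_num_measure//; have [] := mF k.
  + by move=> k _; exact: measurableI.
  + exact/trivIset_setIl.
Qed.

Section Family.
Context (I : choiceType) (Z : I -> T -> R).
Hypothesis mZ : forall i, measurable_fun setT (Z i).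
Hypothesis indZ : independent_family Z.

Lemma measurable_coord_cyl D : coord_cyl Z D `<=` measurable.
Proof.
move=> _ [s [A [us sD mA ->]]]; apply: bigsetI_measurable => i _.
by rewrite -[X in measurable X]setTI; exact: mZ.
Qed.

Lemma measurable_g_sigma_coord D : <<s coord_gen Z D >> `<=` measurable.
Proof.
apply: smallest_sub; first exact: sigma_algebra_measurable.
by apply: subset_trans (@measurable_coord_cyl D); exact: coord_gen_cyl.
Qed.

Lemma independent_coord_cyl D1 D2 A B : D1 `&` D2 = set0 ->
  coord_cyl Z D1 A -> coord_cyl Z D2 B -> P (A `&` B) = (P A * P B)%E.
Proof.
move=> D12 [s [C [us sD mC ->]]] [s' [C' [us' sD' mC' ->]]].
have ss' i : i \in s' -> i \in s = false.
  move=> is'; apply/negP => iss.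
  have : (D1 `&` D2) i by split; [exact: sD|exact: sD'].
  by rewrite D12.
(* The two lists of coordinates are disjoint, so a single family [E] over [s ++ s'] describes both
   cylinders. *)
pose E i := if i \in s then C i else C' i.
have eC : \big[setI/setT]_(i <- s) (Z i @^-1` C i) =
          \big[setI/setT]_(i <- s) (Z i @^-1` E i).
  by apply: eq_big_seq => i si; rewrite /E si.
have eC' : \big[setI/setT]_(i <- s') (Z i @^-1` C' i) =
          \big[setI/setT]_(i <- s') (Z i @^-1` E i).
  by apply: eq_big_seq => i si; rewrite /E ss'.
have mE i : measurable (E i) by rewrite /E; case: ifP.
rewrite eC eC' -big_cat /= !indZ// ?big_cat//=.
rewrite cat_uniq us us' andbT /=; apply/hasPn => i /ss' /=.
by move=> ->.
Qed.

(** Two applications of the pi-lambda theorem: a cylinder over [D1] is fixed while the second set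
    varies, then [B] is fixed while the first set varies. *)
Lemma independent_g_sigma_coord D1 D2 A B : D1 `&` D2 = set0 ->
  <<s coord_gen Z D1 >> A -> <<s coord_gen Z D2 >> B ->
  P (A `&` B) = (P A * P B)%E.
Proof.
move=> D12 /sub_g_sigma_coord_cyl sA /sub_g_sigma_coord_cyl sB.
have h C : coord_cyl Z D1 C ->
    <<s coord_cyl Z D2 >> `<=` [set B | measurable B /\ P (C `&` B) = (P C * P B)%E].
  move=> cC; apply: g_sigma_sub_dynkin.
  - exact: coord_cyl_setI.
  - by apply: dynkin_independent; exact: measurable_coord_cyl cC.
  - move=> D cD; split; first exact: measurable_coord_cyl cD.
    exact: independent_coord_cyl cC cD.
have mB : measurable B by have [] := h _ (coord_cyl_setT _ _) _ sB.
have : <<s coord_cyl Z D1 >> `<=`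
    [set C | measurable C /\ P (B `&` C) = (P B * P C)%E].
  apply: g_sigma_sub_dynkin.
  - exact: coord_cyl_setI.
  - exact: dynkin_independent.
  - move=> D cD; split; first exact: measurable_coord_cyl cD.
    by rewrite setIC muleC; have [] := h _ cD _ sB.
by move=> /(_ _ sA)[_]; rewrite setIC muleC.
Qed.

Lemma independent_coord_fun D1 D2 (X Y : T -> R) : D1 `&` D2 = set0 ->
  measurable_fun [set: g_sigma_algebraType (coord_gen Z D1)] X ->
  measurable_fun [set: g_sigma_algebraType (coord_gen Z D2)] Y ->
  independent_rv X Y.
Proof.
move=> D12 mX mY A B mA mB; apply: (independent_g_sigma_coord D12).
  by have := mX measurableT _ mA; rewrite setTI.
by have := mY measurableT _ mB; rewrite setTI.
Qed.

Lemma measurable_coord_fun D (X : T -> R) :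
  measurable_fun [set: g_sigma_algebraType (coord_gen Z D)] X ->
  measurable_fun setT X.
Proof.
move=> mX _ B mB; apply: (@measurable_g_sigma_coord D).
exact: mX.
Qed.

End Family.

(** The evaluation maps generate the product sigma-algebra on the space of paths [I -> R]. *)
Definition path_gen (I : choiceType) : set (set (I -> R)) :=
  coord_gen (fun i (p : I -> R) => p i) setT.

(** * The law of the path of an independent family *)

Section PathLaw.
Context (I : choiceType) (Z Z' : I -> T -> R).
Hypothesis mZ : forall i, measurable_fun setT (Z i).
Hypothesis mZ' : forall i, measurable_fun setT (Z' i).
Hypothesis indZ : independent_family Z.
Hypothesis indZ' : independent_family Z'.
Hypothesis ZZ' : forall i (A : set R), measurable A ->
  P (Z i @^-1` A) = P (Z' i @^-1` A).

(** Independence and equal marginals give agreement on cylinders, which determines the law of the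
    path. Both stationarity and the common law of the digit rows rest on this. *)
Lemma path_law (C : set (I -> R)) : <<s @path_gen I >> C ->
  P [set w | C (Z ^~ w)] = P [set w | C (Z' ^~ w)].
Proof.
move=> /sub_g_sigma_coord_cyl.
suff h : <<s coord_cyl (fun i (p : I -> R) => p i) setT >> `<=`
    [set C | [/\ measurable [set w | C (Z ^~ w)], measurable [set w | C (Z' ^~ w)]
     & P [set w | C (Z ^~ w)] = P [set w | C (Z' ^~ w)]]].
  by move=> /h[].
apply: g_sigma_sub_dynkin; first exact: coord_cyl_setI.
- split => /=.
  + by split => //; exact: measurableT.
  + move=> B [mB mB' PB]; split.
    * exact: measurableC mB.
    * exact: measurableC mB'.
    * rewrite -[X in P X = _]/(~` [set w | B (Z ^~ w)]).
      rewrite -[X in _ = P X]/(~` [set w | B (Z' ^~ w)]).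
      by rewrite !probability_setC// PB.
  + move=> F tF hF.
    have t (Y : I -> T -> R) : trivIset setT (fun k => [set w | F k (Y ^~ w)]).
      apply/trivIsetP => i j _ _ ij; apply/seteqP; split => // w [/= h1 h2].
      have /trivIsetP/(_ i j Logic.I Logic.I ij) := tF.
      by move=> /seteqP[/(_ (Y ^~ w) (conj h1 h2))].
    have m1 k : measurable [set w | F k (Z ^~ w)] by have [] := hF k.
    have m2 k : measurable [set w | F k (Z' ^~ w)] by have [] := hF k.
    suff : [/\ measurable (\bigcup_k [set w | F k (Z ^~ w)]),
        measurable (\bigcup_k [set w | F k (Z' ^~ w)]) &
        P (\bigcup_k [set w | F k (Z ^~ w)]) = P (\bigcup_k [set w | F k (Z' ^~ w)])].
      by [].
    split; [exact: bigcupT_measurable..|].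
    rewrite !measure_bigcup//; apply: eq_eseriesr => k _.
    by have [] := hF k.
- move=> _ [s [A [us _ mA ->]]] /=.
  have e (Y : I -> T -> R) :
      [set w | (\big[setI/setT]_(i <- s) ((fun p => p i) @^-1` A i)) (Y ^~ w)] =
      \big[setI/setT]_(i <- s) (Y i @^-1` A i).
    by apply/seteqP; split => w /= /big_setI_seqP h; apply/big_setI_seqP.
  rewrite !e; split.
  + apply: (@measurable_coord_cyl _ Z mZ setT); exists s, A; split => //.
  + apply: (@measurable_coord_cyl _ Z' mZ' setT); exists s, A; split => //.
  + rewrite indZ// indZ'//; apply: eq_bigr => i _; exact: ZZ'.
Qed.

End PathLaw.
End Independence.

(** * Binary digits of a uniform point *)

Section Bits.
Context (R : realType).
Let P : probability (measurableTypeR R) R := uniform_prob (@ltr01 R).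

(** For [x] in [0, 1) this is the binary digit of weight [2^-(n+1)], taken as a real number so that
    [independent_family] applies. *)
Definition bit (n : nat) (x : R) : R := (odd (Num.truncn (2 ^+ n.+1 * x)))%:R.

Definition dyadic (m k : nat) : set R :=
  `[k%:R / 2 ^+ m, k.+1%:R / 2 ^+ m[%classic.

(** The law of a fair coin with values 0 and 1. *)
Definition bit_weight (A : set R) : R := (\1_A 0 + \1_A 1) / 2.

Lemma uniform01E (A : set R) : measurable A ->
  P A = lebesgue_measure (A `&` `[0, 1]).
Proof.
move=> mA; transitivity (\int[lebesgue_measure]_(x in A) (uniform_pdf 0 1 x)%:E)%E; first by [].
rewrite integral_uniform_pdf.
under eq_integral.
  move=> x; rewrite inE => -[_ /=]; rewrite in_itv /= => x01.
  rewrite /uniform_pdf x01 subr0 invr1.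
  over.
by rewrite integral_cst ?mul1e//; exact: measurableI.
Qed.

Lemma truncn_half (y : R) : (Num.truncn (2 * y))./2 = Num.truncn y.
Proof.
(* [Num.truncn] is 0 on negative reals, so both sides vanish there. *)
have [y0|y0] := leP 0 y; last first.
  have -> : Num.truncn y = 0%N by apply/eqP; rewrite -leqn0 truncn_le_nat; lra.
  have -> // : Num.truncn (2 * y) = 0%N by apply/eqP; rewrite -leqn0 truncn_le_nat; lra.
apply/esym/truncn_def.
have /andP[h1 h2] : (Num.truncn (2 * y))%:R <= 2 * y < (Num.truncn (2 * y)).+1%:R.
  by apply: truncn_itv; lra.
move: (Num.truncn _) h1 h2 => k.
rewrite -(odd_double_half k) half_bit_double -addnS -mul2n.
by case: odd => /=; rewrite ?add0n ?add1n -?natr1 ?natrD ?natrM -?natr1 => h1 h2; lra.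
Qed.

Lemma truncn_bit n (x : R) : Num.truncn (2 ^+ n.+1 * x) =
  ((Num.truncn (2 ^+ n * x)).*2 + odd (Num.truncn (2 ^+ n.+1 * x)))%N.
Proof. by rewrite -[Num.truncn (2 ^+ n * x)]truncn_half mulrA -exprS addnC odd_double_half. Qed.

(** In this form a digit is visibly measurable, truncations being monotone, and the binary expansion
    telescopes. *)
Lemma bitE n x : bit n x =
  (Num.truncn (2 ^+ n.+1 * x))%:R - 2 * (Num.truncn (2 ^+ n * x))%:R.
Proof. by rewrite [in RHS]truncn_bit natrD -mul2n natrM /bit; ring. Qed.

Lemma measurable_bit n : measurable_fun setT (bit n).
Proof.
have mt m : measurable_fun setT (fun x : R => (Num.truncn (2 ^+ m * x))%:R : R).
  apply: nondecreasing_measurable => // x y xy.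
  by rewrite ler_nat; apply: le_truncn; rewrite ler_pM2l ?exprn_gt0.
rewrite (_ : bit n = fun x => (Num.truncn (2 ^+ n.+1 * x))%:R -
    2 * (Num.truncn (2 ^+ n * x))%:R); last by apply/funext => x; exact: bitE.
by apply: measurable_funB => //; exact: measurable_funM.
Qed.

Lemma dyadicP m k x : 0 <= x -> dyadic m k x <-> Num.truncn (2 ^+ m * x) = k.
Proof.
move=> x0; rewrite /dyadic /= in_itv /= ler_pdivrMr ?exprn_gt0// ltr_pdivlMr ?exprn_gt0//.
rewrite mulrC; split.
  by move=> h; apply: truncn_def.
move=> <-; apply: truncn_itv; by rewrite mulr_ge0// exprn_ge0.
Qed.

Lemma dyadic_ge0 m k x : dyadic m k x -> 0 <= x.
Proof.
rewrite /dyadic /= in_itv /= => /andP[h _]; apply: le_trans h.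
by rewrite divr_ge0// exprn_ge0.
Qed.

Lemma dyadic_bit m k (b : bool) x :
  dyadic m.+1 (k.*2 + b) x <-> dyadic m k x /\ bit m x = b%:R.
Proof.
split=> [h|[dx]].
  have x0 := dyadic_ge0 h; move: h => /(dyadicP _ _ x0) h.
  split; last by rewrite /bit h oddD odd_double oddb.
  by apply/dyadicP => //; rewrite -truncn_half mulrA -exprS h addnC half_bit_double.
have x0 := dyadic_ge0 dx; move: dx => /(dyadicP _ _ x0) dx.
rewrite /bit => /eqP; rewrite eqr_nat => /eqP h.
by apply/dyadicP => //; rewrite truncn_bit dx h.
Qed.

Lemma dyadic_measure m k : (k < 2 ^ m)%N -> P (dyadic m k) = ((2 ^+ m)^-1)%:E.
Proof.
move=> km; rewrite uniform01E; last exact: measurable_itv.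
rewrite setIidl; last first.
  move=> x; rewrite /dyadic /= !in_itv/= => /andP[h1 h2]; apply/andP; split.
    by apply: le_trans h1; rewrite divr_ge0// exprn_ge0.
  rewrite ltW// (lt_le_trans h2)// ler_pdivrMr ?exprn_gt0// mul1r.
  by rewrite -natrX ler_nat.
rewrite /dyadic lebesgue_measure_itv /= lte_fin ltr_pM2r ?invr_gt0 ?exprn_gt0// ltr_nat ltnSn.
by rewrite -EFinB -mulrBl -natrB// subSnn mul1r.
Qed.

(* Each step halves the dyadic interval according to the value of [bit m]. *)
Lemma dyadic_bits_measure n m k (A : nat -> set R) : (k < 2 ^ m)%N ->
  (forall i, measurable (A i)) ->
  P (dyadic m k `&` \big[setI/setT]_(i <- iota m n) (bit i @^-1` A i)) =
  ((2 ^+ m)^-1 * \prod_(i <- iota m n) bit_weight (A i))%:E.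
Proof.
move=> km mA; elim: n m k km => [|n ih] m k km.
  by rewrite !big_nil setIT mulr1 dyadic_measure.
rewrite /= !big_cons; set B := \big[setI/setT]_(i <- _) _.
pose part (b : bool) := if b%:R \in A m then dyadic m.+1 (k.*2 + b) `&` B else set0.
have mB : measurable B.
  apply: bigsetI_measurable => i _.
  by rewrite -[X in measurable X]setTI; exact: measurable_bit.
have mpart b : measurable (part b).
  rewrite /part; case: ifP => // _; apply: measurableI => //.
  exact: measurable_itv.
have kb (b : bool) : (k.*2 + b < 2 ^ m.+1)%N.
  rewrite expnS mul2n; apply: (@leq_trans (k.+1).*2); last by rewrite leq_double.
  by rewrite doubleS -addnS -addn2 leq_add2l; case: b.
have -> : dyadic m k `&` (bit m @^-1` A m `&` B) = part false `|` part true.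
  apply/seteqP; split => x.
    move=> [dx [Ax Bx]]; rewrite /part.
    have : bit m x = (odd (Num.truncn (2 ^+ m.+1 * x)))%:R by [].
    case: odd => bx; [right|left].
      rewrite ifT; last by rewrite inE -bx.
      by split => //; apply/dyadic_bit.
    rewrite ifT; last by rewrite inE -bx.
    by split => //; apply/dyadic_bit.
  by case; rewrite /part; case: ifPn => //; rewrite inE => A1 [/dyadic_bit[dx bx] Bx];
    split => //; split => //=; rewrite bx.
have part0 : part false `&` part true = set0.
  apply/seteqP; split => // x [].
  rewrite /part; do 2 (case: ifPn => // _).
  move=> [/dyadic_bit[_ h1] _] [/dyadic_bit[_ h2] _].
  by move: h1; rewrite h2 => /eqP; rewrite oner_eq0.
rewrite measureU; [|exact: mpart|exact: mpart|exact: part0].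
have Ppart b : P (part b) = (\1_(A m) b%:R * ((2 ^+ m.+1)^-1 *
    \prod_(i <- iota m.+1 n) bit_weight (A i)))%:E.
  rewrite /part indicE; case: (b%:R \in A m); last by rewrite mul0r measure0.
  by rewrite ih// mul1r.
apply: (etrans (congr2 adde (Ppart false) (Ppart true))); rewrite [LHS]/=.
rewrite /adde /dual_adde /bit_weight; congr EFin.
by rewrite exprS invfM; field; rewrite ?expf_neq0.
Qed.
End Bits.

(** * Independent exponential variables *)

Section Blocks.
Context d (T : measurableType d) (R : realType) (P : probability T R).

Lemma probability1_setI (D B : set T) : measurable D -> measurable B ->
  P D = 1%E -> P (D `&` B) = P B.
Proof.
move=> mD mB PD; rewrite setIC; apply/esym.
rewrite [LHS](measureDI P mB mD) -[RHS]add0e; congr (_ + _)%E.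
apply/eqP; rewrite eq_le measure_ge0 andbT.
have <- : P (~` D) = 0%E by rewrite probability_setC// PD subee.
by apply: le_measure; rewrite ?inE; [exact: measurableD|exact: measurableC|move=> x []].
Qed.

Lemma measurable_fun_coord_sub (I : choiceType) (Z : I -> T -> R) D D' (X : T -> R) :
  D `<=` D' ->
  measurable_fun [set: g_sigma_algebraType (coord_gen Z D)] X ->
  measurable_fun [set: g_sigma_algebraType (coord_gen Z D')] X.
Proof.
move=> DD' mX _ B mB; have := mX measurableT B mB.
by apply: sub_sigma_algebra2; apply: bigcup_subset.
Qed.

(** Induction on the list of blocks: the event of the head depends on its own block, the remaining
    events on the union of the others, and these two sets of coordinates are disjoint. *)
Lemma independent_blocks (I J : choiceType) (Z : I -> T -> R) (D : J -> set I)
    (Y : J -> T -> R) :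
  (forall i, measurable_fun setT (Z i)) -> independent_family P Z ->
  (forall j j', j != j' -> D j `&` D j' = set0) ->
  (forall j, measurable_fun [set: g_sigma_algebraType (coord_gen Z (D j))] (Y j)) ->
  independent_family P Y.
Proof.
move=> mZ iZ dD mY; elim => [|j s ih] A us mA.
  by rewrite !big_nil probability_setT.
move: us => /= /andP[js us]; rewrite !big_cons -ih//.
pose E := \bigcup_(j' in [set` s]) D j'.
apply: (@independent_g_sigma_coord _ _ _ _ _ Z mZ iZ (D j) E).
- apply/seteqP; split => // i [Di [j' /= j's Dj']].
  have : (D j `&` D j') i by split.
  by rewrite dD//; apply: contra js => /eqP ->.
- by have := mY j measurableT _ (mA j); rewrite setTI.
- suff : (@measurable _ (g_sigma_algebraType (coord_gen Z E)))
    (\big[setI/setT]_(i <- s) (Y i @^-1` A i)) by [].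
  rewrite big_seq; apply: bigsetI_measurable => i si.
  rewrite -[X in measurable X]setTI.
  apply: (@measurable_fun_coord_sub _ Z (D i) E) => //.
  by move=> k Dk; exists i.
Qed.

End Blocks.

Section Exponentials.
Context (R : realType).
Let P : probability (measurableTypeR R) R := uniform_prob (@ltr01 R).

Lemma measurable_dyadic m k : measurable (@dyadic R m k).
Proof. exact: measurable_itv. Qed.

Lemma uniform_dyadic00 : P (@dyadic R 0 0) = 1%E.
Proof. by rewrite dyadic_measure// expr0 invr1. Qed.

Lemma measurable_bit_preimage i (A : set R) : measurable A ->
  measurable (bit i @^-1` A : set R).
Proof.
by move=> mA; rewrite -[X in measurable X]setTI; exact: (@measurable_bit R i).
Qed.

(** Digits up to the largest index in [s] are all included, those outside [s] with the constraint
    [setT] of weight 1; then [dyadic 0 0], which is [0, 1), has full measure. *)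
Lemma bits_measure (s : seq nat) (A : nat -> set R) : uniq s ->
  (forall i, measurable (A i)) ->
  P (\big[setI/setT]_(i <- s) (bit i @^-1` A i)) =
  (\prod_(i <- s) bit_weight (A i))%:E.
Proof.
move=> us mA; pose n := (\max_(i <- s) i).+1.
have sn i : i \in s -> (i < n)%N by move=> si; rewrite ltnS leq_bigmax_seq.
pose B i := if i \in s then A i else setT.
have mB i : measurable (B i) by rewrite /B; case: ifP.
have -> : \big[setI/setT]_(i <- s) (bit i @^-1` A i) =
    \big[setI/setT]_(i <- iota 0 n) (bit i @^-1` B i) :> set R.
  apply/seteqP; split => x /big_setI_seqP h; apply/big_setI_seqP => i si.
    by rewrite /B; case: ifP => // /h.
  have := h i; rewrite mem_iota /= add0n sn// => /(_ isT).
  by rewrite /B si.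
rewrite -(@probability1_setI _ _ _ P (@dyadic R 0 0)).
- rewrite /P dyadic_bits_measure// expr0 invr1 mul1r; congr EFin.
  transitivity (\prod_(i <- iota 0 n | i \in s) bit_weight (A i)).
    rewrite [RHS]big_mkcond; apply: eq_bigr => i _; rewrite /B.
    by case: ifP => // _; rewrite /bit_weight !indicE !in_setT /= mulrV ?unitfE.
  rewrite -big_filter; apply: perm_big; apply: uniq_perm => //.
    by rewrite filter_uniq// iota_uniq.
  move=> i; rewrite mem_filter mem_iota /= add0n.
  by case: (boolP (i \in s)) => // /sn ->.
- exact: measurable_dyadic.
- by apply: bigsetI_measurable => i _; exact: measurable_bit_preimage.
- exact: uniform_dyadic00.
Qed.

Lemma bit_law i (A : set R) : measurable A -> P (bit i @^-1` A) = (bit_weight A)%:E.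
Proof.
move=> mA; have := @bits_measure [:: i] (fun=> A) isT (fun=> mA).
by rewrite !big_seq1.
Qed.

Lemma bits_independent : independent_family P (@bit R).
Proof.
move=> s A us mA; rewrite bits_measure// -prodEFin; apply: eq_bigr => i _.
by rewrite bit_law.
Qed.

(** The absolute value is harmless for digits and makes all terms nonnegative, so that the sum is
    measurable on the whole path space. *)
Definition digit_sum (f : nat -> R) : R :=
  fine (\sum_(i <oo) (`|f i| / 2 ^+ i.+1)%:E)%E.

(* The minimum keeps this nonnegative for every [f], also where the series
   diverges. *)
Definition exp_of_digits (f : nat -> R) : R := - ln (Num.min 1 (digit_sum f)).

Lemma exp_of_digits_ge0 f : 0 <= exp_of_digits f.
Proof. by rewrite /exp_of_digits oppr_ge0 ln_le0// ge_min lexx. Qed.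

Lemma measurable_exp_of_digits d (X : measurableType d) (f : nat -> X -> R) :
  (forall i, measurable_fun setT (f i)) ->
  measurable_fun setT (fun x => exp_of_digits (f ^~ x)).
Proof.
move=> mf; apply: measurable_funN; apply: measurableT_comp.
  exact: measurable_realfun.measurable_ln.
apply: measurable_minr => //; apply: measurableT_comp => //.
apply: ge0_emeasurable_sum => [k x _ _|k _].
  by rewrite lee_fin divr_ge0// exprn_ge0.
apply/measurable_EFinP; apply: measurable_funM => //.
by apply: measurableT_comp => //; exact: mf.
Qed.

Lemma bit_partial_sum n (x : R) : 0 <= x < 1 ->
  \sum_(0 <= i < n) `|bit i x| / 2 ^+ i.+1 = (Num.truncn (2 ^+ n * x))%:R / 2 ^+ n.
Proof.
move=> /andP[x0 x1]; elim: n => [|n ih].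
  rewrite big_geq// expr0 mul1r invr1 mulr1.
  have -> : Num.truncn x = 0%N by apply/eqP; rewrite -leqn0 truncn_le_nat.
  by [].
rewrite big_nat_recr//= ih ger0_norm; last by rewrite /bit ler0n.
by rewrite bitE exprS; field; rewrite expf_neq0.
Qed.

Lemma digit_sum_bit (x : R) : 0 <= x < 1 -> digit_sum (@bit R ^~ x) = x.
Proof.
move=> x01; have /andP[x0 _] := x01.
suff h : (fun n => \sum_(0 <= i < n) (`|bit i x| / 2 ^+ i.+1)%:E)%E @ \oo --> x%:E.
  by rewrite /digit_sum (cvg_lim _ h).
under eq_cvg => n do rewrite sumEFin bit_partial_sum//.
apply: cvg_EFin; first exact: nearW.
(* The partial sum truncates [x] after [n] digits, hence lies between [x - 2^-n] and [x]. *)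
apply: (@squeeze_cvgr _ _ _ _ (fun n => x - 2^-1 ^+ n) (cst x)); last exact: cvg_cst.
  apply: nearW => n /=.
  have /andP[h1 h2] : (Num.truncn (2 ^+ n * x))%:R <= 2 ^+ n * x < (Num.truncn (2 ^+ n * x)).+1%:R.
    by apply: truncn_itv; rewrite mulr_ge0// exprn_ge0.
  rewrite ler_pdivrMr ?exprn_gt0// [x * _]mulrC h1 andbT.
  rewrite ler_pdivlMr ?exprn_gt0// mulrBl -exprMn mulVf// expr1n lerBlDr mulrC natr1.
  exact: ltW.
rewrite -[X in _ --> X]subr0; apply: cvgB; first exact: cvg_cst.
by apply: cvg_expr; rewrite ger0_norm//; lra.
Qed.

Lemma exp_of_bits_tail (z : R) :
  P [set w | z < exp_of_digits (@bit R ^~ w)] = (Num.min 1 (expR (- z)))%:E.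
Proof.
have mE : measurable [set w : R | z < exp_of_digits (@bit R ^~ w)].
  have m : measurable_fun (setT : set (measurableTypeR R))
    (fun w => exp_of_digits (@bit R ^~ w)).
    by apply: measurable_exp_of_digits; exact: measurable_bit.
  rewrite (_ : [set w | _] = setT `&` (fun w => exp_of_digits (@bit R ^~ w)) @^-1` `]z, +oo[%classic).
    by apply: m => //; exact: measurable_itv.
  by rewrite setTI; apply/seteqP; split => x /=; rewrite in_itv /= andbT.
have [z0|z0] := ltP z 0.
  rewrite (_ : [set w | _] = setT); last first.
    by apply/seteqP; split => // w _ /=; apply: lt_le_trans z0 _; exact: exp_of_digits_ge0.
  rewrite probability_setT; congr EFin; apply/esym/min_idPl.
  by rewrite -expR0 ler_expR oppr_ge0 ltW.
(* On [0, 1), a set of full measure, the digits reproduce the point itself, so the event becomes an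
   interval of length [expR (- z)]. *)
rewrite -(@probability1_setI _ _ _ P (@dyadic R 0 0))//; last 2 first.
  exact: measurable_dyadic.
  exact: uniform_dyadic00.
have e1 : expR (- z) <= 1 by rewrite -[leRHS]expR0 ler_expR oppr_le0.
rewrite (_ : _ `&` _ = `]0, expR (- z)[%classic); last first.
  rewrite /dyadic expr0 !divr1; apply/seteqP; split => x /=; rewrite !in_itv/=.
    move=> [/andP[x0 x1]]; rewrite /exp_of_digits digit_sum_bit ?x0// (min_idPr (ltW x1)).
    (* At [x = 0] the default value [ln 0 = 0] applies, and 0 does not exceed [z]. *)
    move: x0; rewrite le_eqVlt => /predU1P[<-|x0]; first by rewrite ln0// oppr0 ltNge z0.
    by rewrite x0 /= ltrNr => h; rewrite -[x]lnK ?posrE// ltr_expR.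
  move=> /andP[x0 xz]; have x1 : x < 1 by exact: lt_le_trans xz e1.
  split; first by rewrite ltW.
  rewrite /exp_of_digits digit_sum_bit ?(ltW x0)// (min_idPr (ltW x1)).
  by rewrite ltrNr -ltr_expR lnK ?posrE.
rewrite uniform01E; last exact: measurable_itv.
rewrite setIidl; last first.
  move=> x /=; rewrite !in_itv/= => /andP[x0 xz].
  by rewrite ltW//= ltW// (lt_le_trans xz).
rewrite lebesgue_measure_itv /= lte_fin expR_gt0 oppr0 adde0; congr EFin.
by apply/esym/min_idPr.
Qed.

Lemma exists_iid_exponential (J : countType) : exists Z : J -> measurableTypeR R -> R,
  [/\ forall j, measurable_fun setT (Z j), independent_family P Z,
      forall j w, 0 <= Z j w,
      forall j z, P [set w | z < Z j w] = (Num.min 1 (expR (- z)))%:E &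
      forall j k (A : set R), measurable A -> P (Z j @^-1` A) = P (Z k @^-1` A)].
Proof.
(* [pickle] codes pairs injectively, so distinct rows [j] use disjoint sets of digits. *)
pose b (j : J) (i : nat) := @bit R (pickle (j, i)).
pose Z j (w : measurableTypeR R) := exp_of_digits (b j ^~ w).
have mb i : measurable_fun setT (@bit R i : measurableTypeR R -> R) by exact: measurable_bit.
(* Each row of digits has the same path law as the full digit sequence, for which the tail is
   known. *)
have law j A : measurable A -> P (Z j @^-1` A) = P [set w | A (exp_of_digits (@bit R ^~ w))].
  move=> mA.
  have mC : <<s @path_gen R nat >> [set f | A (exp_of_digits f)].
    have := @measurable_exp_of_digits _ (g_sigma_algebraType (@path_gen R nat))
      (fun i p => p i).
    move=> /(_ (fun i => @measurable_coord R _ _ (fun i (p : nat -> R) => p i) setT i Logic.I)).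
    by move=> /(_ measurableT _ mA); rewrite setTI.
  apply: (@path_law _ _ _ P _ (b j) (@bit R) _ _ _ _ _ _ mC).
  - by move=> i; exact: mb.
  - exact: mb.
  - apply: (@independent_family_inj _ _ _ P nat nat (fun i => pickle (j, i)) (@bit R)).
      by move=> i i' /(pcan_inj pickleK)[].
    exact: bits_independent.
  - exact: bits_independent.
  - by move=> i B mB; rewrite /b !bit_law.
exists Z; split.
- by move=> j; apply: measurable_exp_of_digits => i; exact: mb.
- apply: (@independent_blocks _ _ _ P _ _ (@bit R)
    (fun j => [set pickle (j, i) | i in [set: nat]])) => //.
  + exact: bits_independent.
  + move=> j j' jj'; apply/seteqP; split => // _ [[i _ <-] [i' _]].
    by move=> /(pcan_inj pickleK)[j'j]; rewrite j'j eqxx in jj'.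
  + move=> j; apply: measurable_exp_of_digits => i.
    by apply: measurable_coord; exists i.
- by move=> j w; exact: exp_of_digits_ge0.
- move=> j z; rewrite -exp_of_bits_tail.
  have mz : measurable `]z, +oo[%classic by exact: measurable_itv.
  have := law j _ mz.
  rewrite /preimage (_ : [set t | _] = [set w | z < Z j w]); last first.
    by apply/seteqP; split => x /=; rewrite in_itv /= andbT.
  move=> ->; congr (P _).
  by apply/seteqP; split => x /=; rewrite in_itv /= andbT.
- by move=> j k A mA; rewrite (law j A mA) (law k A mA).
Qed.

End Exponentials.

(** * Truncated moment generating functions *)

Section IndependentIntegral.
Context d (T : measurableType d) (R : realType) (P : probability T R).

(** By uniqueness of the product measure, independence makes the law of the pair a product; Tonelli
    does the rest. *)
Lemma independent_rv_integral (X Y : T -> R) (f : R * R -> \bar R) :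
  measurable_fun setT X -> measurable_fun setT Y -> independent_rv P X Y ->
  measurable_fun setT f -> (forall z, 0 <= f z)%E ->
  (\int[P]_w f (X w, Y w) = \int[P]_w \int[P]_v f (X w, Y v))%E.
Proof.
move=> mX mY iXY mf f0.
pose X' : {mfun T >-> R} := HB.pack X (isMeasurableFun.Build _ _ _ _ X mX).
pose Y' : {mfun T >-> R} := HB.pack Y (isMeasurableFun.Build _ _ _ _ Y mY).
have mXY : measurable_fun setT (fun w => (X w, Y w)).
  exact: measurable_fun_pair.
pose XY' : {mfun T >-> (R * R)%type} :=
  HB.pack (fun w => (X w, Y w)) (isMeasurableFun.Build _ _ _ _ (fun w => (X w, Y w)) mXY).
transitivity (\int[distribution P XY']_z f z)%E.
  by rewrite ge0_integral_distribution.
transitivity (\int[distribution P X' \x distribution P Y']_z f z)%E.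
  apply: eq_measure_integral => A mA _; apply/esym.
  apply: product_measure_unique => //.
rewrite fubini_tonelli1// ge0_integral_distribution//; last 2 first.
- exact: measurable_fun_fubini_tonelli_F.
- by move=> y; apply: integral_ge0 => ? _; exact: f0.
apply: eq_integral => w _ /=; rewrite /fubini_F.
rewrite ge0_integral_distribution//.
exact: measurableT_comp.
Qed.

Lemma independent_rv_integral_mul (f g : T -> R) :
  measurable_fun setT f -> measurable_fun setT g -> independent_rv P f g ->
  (\int[P]_w (expR (f w + g w))%:E =
   \int[P]_w (expR (f w))%:E * \int[P]_w (expR (g w))%:E)%E.
Proof.
move=> mf mg fg.
have me : measurable_fun setT (fun z : R * R => (expR (z.1 + z.2))%:E).
  apply/measurable_EFinP; apply: measurableT_comp => //.
  by apply: measurable_funD; [exact: measurable_fst|exact: measurable_snd].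
rewrite (independent_rv_integral (f := fun z => (expR (z.1 + z.2))%:E))//=.
have mE (h : T -> R) : measurable_fun setT h -> measurable_fun setT (fun w => (expR (h w))%:E).
  by move=> mh; apply/measurable_EFinP; exact: measurableT_comp.
under eq_integral => w _.
  under eq_integral => v _ do rewrite expRD EFinM.
  rewrite ge0_integralZl//; [|exact: mE].
  over.
rewrite ge0_integralZr//; first exact: mE.
by apply: integral_ge0.
Qed.

End IndependentIntegral.

(** * Tails of sums with an exponential summand *)

Section TruncatedMgf.
Context d (T : measurableType d) (R : realType) (P : probability T R).
Implicit Types W E : T -> R.

Definition exponential_tail E := forall z : R,
  P [set w | z < E w] = (Num.min 1 (expR (- z)))%:E.

(** The function [M_W] of the overview, as [min(e^z, e^W) = e^(min(z, W))]. The cut bounds the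
    integrand by [e^z], so [fine] loses nothing. *)
Definition truncated_mgf W (z : R) : R :=
  fine (\int[P]_w (expR (Num.min z (W w)))%:E)%E.

(* For monotone [M] this says that [M \o ln] varies slowly at infinity. *)
Definition slowly_increasing (M : R -> R) :=
  [/\ forall z, 0 < M z, {homo M : x y / x <= y} &
   forall s e, 0 < s -> 0 < e -> exists z0, forall z, z0 <= z ->
     M (z + s) <= (1 + e) * M z].

Lemma measurable_expR_min W z : measurable_fun setT W ->
  measurable_fun setT (fun w => (expR (Num.min z (W w)))%:E).
Proof.
move=> mW; apply/measurable_EFinP; apply: measurableT_comp => //.
exact: measurable_minr.
Qed.

Lemma measurable_gt W z : measurable_fun setT W -> measurable [set w | z < W w].
Proof.
move=> mW; rewrite (_ : [set w | _] = setT `&` W @^-1` `]z, +oo[%classic).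
  by apply: mW => //; exact: measurable_itv.
by rewrite setTI; apply/seteqP; split => x /=; rewrite in_itv /= andbT.
Qed.

Lemma truncated_mgfE W z : measurable_fun setT W ->
  (truncated_mgf W z)%:E = (\int[P]_w (expR (Num.min z (W w)))%:E)%E.
Proof.
move=> mW; rewrite /truncated_mgf fineK// ge0_fin_numE; last first.
  by apply: integral_ge0.
apply: (@le_lt_trans _ _ (\int[P]_w (cst (expR z)%:E) w)%E).
  apply: ge0_le_integral => //; [exact: measurable_expR_min|].
  by move=> w _; rewrite lee_fin ler_expR ge_min lexx.
by rewrite integral_cst//= probability_setT mule1 ltry.
Qed.

Lemma le_truncated_mgf W W' z z' : measurable_fun setT W -> measurable_fun setT W' ->
  z <= z' -> (forall w, W w <= W' w) -> truncated_mgf W z <= truncated_mgf W' z'.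
Proof.
move=> mW mW' zz WW; rewrite -lee_fin !truncated_mgfE//.
apply: ge0_le_integral => //; [exact: measurable_expR_min..|].
move=> w _; rewrite lee_fin ler_expR.
by rewrite le_min !ge_min zz WW orbT.
Qed.

Lemma truncated_mgf_gt0 W z : measurable_fun setT W -> (forall w, 0 <= W w) ->
  0 < truncated_mgf W z.
Proof.
move=> mW W0; apply: (@lt_le_trans _ _ (expR (Num.min z 0))); first exact: expR_gt0.
rewrite -lee_fin truncated_mgfE//.
rewrite -[leLHS]mule1 -(@probability_setT _ _ _ P) -integral_cst//.
apply: ge0_le_integral => //; first by move=> w _; rewrite lee_fin expR_ge0.
  exact: measurable_expR_min.
move=> w _; rewrite lee_fin ler_expR.
by rewrite le_min !ge_min lexx W0 orbT.
Qed.

Lemma measurable_scaled_indic (c : R) (A : set T) : measurable A ->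
  measurable_fun setT (fun w => (c * \1_A w)%:E).
Proof. by move=> mA; apply/measurable_EFinP; apply: measurable_funM. Qed.

Lemma integral_scaled_indic (c : R) (A : set T) : 0 <= c -> measurable A ->
  (\int[P]_w (c * \1_A w)%:E = c%:E * P A)%E.
Proof.
move=> c0 mA; under eq_integral do rewrite EFinM.
rewrite ge0_integralZl//; first by rewrite integral_indic// setIT.
by apply/measurable_EFinP.
Qed.

(** Raising the cut changes the integrand only where [W > z], and there by at most
    [e^(z + s) - e^z]. *)
Lemma truncated_mgfD_le W z s : measurable_fun setT W -> 0 <= s ->
  truncated_mgf W (z + s) <= truncated_mgf W z +
    (expR (z + s) - expR z) * fine (P [set w | z < W w]).
Proof.
move=> mW s0; have mA := measurable_gt z mW.
have c0 : 0 <= expR (z + s) - expR z by rewrite subr_ge0 ler_expR lerDl.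
rewrite -lee_fin EFinD EFinM !truncated_mgfE// (fineK (fin_num_measure P _ mA)).
rewrite -integral_scaled_indic// -ge0_integralD//; last 3 first.
- exact: measurable_expR_min.
- by move=> w _; rewrite lee_fin mulr_ge0.
- exact: measurable_scaled_indic.
apply: ge0_le_integral => //; first exact: measurable_expR_min.
- by apply: emeasurable_funD; [exact: measurable_expR_min|exact: measurable_scaled_indic].
move=> w _; rewrite -EFinD lee_fin indicE; have [zW|Wz] := ltP z (W w).
  rewrite mem_set//= mulr1 addrCA subrr addr0 ler_expR.
  by rewrite ge_min lexx.
rewrite memNset/= ?ltNge ?Wz// mulr0 addr0 ler_expR min_r//.
by rewrite (le_trans Wz)// lerDl.
Qed.

(** Where [W > z + s] the integrand gains exactly [e^(z + s) - e^z]; elsewhere it does not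
    decrease. *)
Lemma truncated_mgfD_ge W z s : measurable_fun setT W -> 0 <= s ->
  truncated_mgf W z + (expR (z + s) - expR z) * fine (P [set w | z + s < W w])
  <= truncated_mgf W (z + s).
Proof.
move=> mW s0; have mA := measurable_gt (z + s) mW.
have c0 : 0 <= expR (z + s) - expR z by rewrite subr_ge0 ler_expR lerDl.
rewrite -lee_fin EFinD EFinM !truncated_mgfE// (fineK (fin_num_measure P _ mA)).
rewrite -integral_scaled_indic// -ge0_integralD//; last 3 first.
- exact: measurable_expR_min.
- by move=> w _; rewrite lee_fin mulr_ge0.
- exact: measurable_scaled_indic.
apply: ge0_le_integral => //.
- by move=> w _; rewrite adde_ge0// lee_fin ?mulr_ge0.
- by apply: emeasurable_funD; [exact: measurable_expR_min|exact: measurable_scaled_indic].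
- exact: measurable_expR_min.
move=> w _; rewrite -EFinD lee_fin indicE; have [zW|Wz] := ltP (z + s) (W w).
  rewrite mem_set//= mulr1 min_l; first by rewrite addrCA subrr addr0.
  by rewrite (le_trans _ (ltW zW))// lerDl.
by rewrite memNset/= ?ltNge ?Wz// mulr0 addr0 ler_expR ge_min lexx orbT.
Qed.

(** For fixed [W], the probability of [E > z - W] is [min(1, e^(W - z))], which equals
    [e^(-z) e^(min(z, W))]; integrate over [W]. *)
Lemma tail_add_exponential W E (z : R) : measurable_fun setT W -> measurable_fun setT E ->
  independent_rv P W E -> exponential_tail E ->
  P [set w | z < W w + E w] = (expR (- z) * truncated_mgf W z)%:E.
Proof.
move=> mW mE iWE tE.
pose f (u : R * R) : \bar R := (\1_[set u : R * R | z < u.1 + u.2] u)%:E.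
have mS : measurable [set u : R * R | z < u.1 + u.2].
  rewrite (_ : [set u | _] = setT `&` (fun u : R * R => u.1 + u.2) @^-1` `]z, +oo[%classic).
    have : measurable_fun setT (fun u : R * R => u.1 + u.2).
      by apply: measurable_funD; [exact: measurable_fst|exact: measurable_snd].
    by apply => //; exact: measurable_itv.
  by rewrite setTI; apply/seteqP; split => x /=; rewrite in_itv /= andbT.
have mf : measurable_fun setT f by apply/measurable_EFinP.
have mWE : measurable [set w | z < W w + E w].
  by apply: measurable_gt; exact: measurable_funD.
transitivity (\int[P]_w f (W w, E w))%E.
  by rewrite -[X in P X]setIT -integral_indic//; exact: eq_integral.
rewrite independent_rv_integral//; last by move=> u; rewrite /f lee_fin.
rewrite EFinM truncated_mgfE// -ge0_integralZl//; last exact: measurable_expR_min.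
apply: eq_integral => w _.
rewrite -EFinM -expRD.
transitivity (P [set v | z - W w < E v]).
  have mv : measurable [set v | z - W w < E v] by exact: measurable_gt.
  rewrite -[X in _ = P X]setIT -integral_indic//; apply: eq_integral => v _.
  rewrite /f !indicE; congr ((nat_of_bool _)%:R%:E).
  by apply/idP/idP; rewrite !inE /= ltrBlDl.
rewrite tE; congr EFin; rewrite opprB; have [zW|Wz] := leP z (W w).
  rewrite addNr expR0; apply/min_idPl.
  by rewrite -[leLHS]expR0 ler_expR subr_ge0.
rewrite [- z + _]addrC; apply/min_idPr.
by rewrite -[leRHS]expR0 ler_expR subr_le0 ltW.
Qed.

(* Both increments of [M' := M_(W + E)] over unit steps and its relative growth
   are controlled by [M := M_W]: [n M(z - n) / 2 <= M'(z)], whereas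
   [M'(z + s) - M'(z) <= (e^s - 1) M(z)], and [M(z) <= 2 M(z - n)] eventually. *)
Lemma slowly_increasing_truncated_mgf_add W E :
  measurable_fun setT W -> measurable_fun setT E ->
  independent_rv P W E -> exponential_tail E -> (forall w, 0 <= W w) ->
  (forall w, 0 <= E w) ->
  slowly_increasing (truncated_mgf W) ->
  slowly_increasing (truncated_mgf (W \+ E)).
Proof.
move=> mW mE iWE tE W0 E0 [M0 Mh Ms].
have mWE : measurable_fun setT (W \+ E) by exact: measurable_funD.
have WE0 w : 0 <= (W \+ E) w by rewrite addr_ge0.
have tail z : fine (P [set w | z < (W \+ E) w]) = expR (- z) * truncated_mgf W z.
  by rewrite tail_add_exponential.
set M := truncated_mgf W in M0 Mh Ms tail *; set M' := truncated_mgf _.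
have M'0 z : 0 < M' z by exact: truncated_mgf_gt0.
have step z : M' z + 2^-1 * M (z + 1) <= M' (z + 1).
  apply: le_trans (truncated_mgfD_ge z mWE ler01).
  rewrite lerD2l tail mulrA ler_wpM2r ?(ltW (M0 _))// mulrBl -!expRD subrr expR0.
  rewrite opprD addrA subrr sub0r expRN.
  have e2 : 2 <= expR 1 :> R by have := @expR_ge1Dx R 1; lra.
  have : (expR 1)^-1 <= 2^-1 :> R by rewrite lef_pV2// posrE ?expR_gt0.
  lra.
have telescope n z : n%:R * 2^-1 * M z <= M' (z + n%:R).
  elim: n => [|n ih]; first by rewrite !mul0r ltW.
  apply: le_trans (_ : M' (z + n%:R) + 2^-1 * M (z + n%:R + 1) <= _); last first.
    by rewrite -[n.+1%:R]natr1 addrA; exact: step.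
  have : M z <= M (z + n%:R + 1) by apply: Mh; rewrite -addrA lerDl addr_ge0.
  by rewrite -[n.+1%:R]natr1; lra.
split => //.
  by move=> x y xy; exact: le_truncated_mgf.
move=> s e s0 e0.
have c0 : 0 < expR s - 1 by rewrite subr_gt0 expR_gt1.
(* This [n] gives [2 (expR s - 1) <= e * n / 2], which compares the upper bound of the increment
   with the telescoped lower bound of [M' z]. *)
pose n := (Num.truncn (4 * (expR s - 1) / e)).+1.
have n0 : 0 < n%:R :> R by rewrite ltr0n.
have nb : 4 * (expR s - 1) <= e * n%:R.
  by rewrite [e * _]mulrC -ler_pdivrMr// ltW// /n truncnS_gt.
have [z1 h1] := Ms n%:R 1 n0 ltr01.
exists (z1 + n%:R) => z zz; apply: (le_trans (truncated_mgfD_le z mWE (ltW s0))).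
have -> : (expR (z + s) - expR z) * fine (P [set w | z < (W \+ E) w]) = (expR s - 1) * M z.
  rewrite tail mulrA mulrBl -!expRD addrAC subrr add0r expR0 //.
have := h1 (z - n%:R); rewrite lerBrDr => /(_ zz); rewrite subrK => Mz.
have := telescope n (z - n%:R); rewrite subrK => Tz.
rewrite [leRHS]mulrDl mul1r lerD2l.
apply: (@le_trans _ _ ((expR s - 1) * (2 * M (z - n%:R)))).
  by rewrite ler_wpM2l ?(ltW c0)//; lra.
apply: (@le_trans _ _ (e * (n%:R / 2 * M (z - n%:R)))).
  rewrite !mulrA ler_wpM2r ?(ltW (M0 _))//; lra.
by rewrite ler_wpM2l// ltW.
Qed.

(** Eventually [M] is within [e * M 0] of its supremum, and for [z >= 0] this margin is at most
    [e * M z]. *)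
Lemma slowly_increasing_bounded (M : R -> R) (C : R) :
  (forall z, 0 < M z) -> {homo M : x y / x <= y} -> (forall z, M z <= C) ->
  slowly_increasing M.
Proof.
move=> M0 Mh MC; split => // s e s0 e0.
have hs : has_sup (range M) by split; [exists (M 0), 0|exists C => _ [z _ <-]].
have eM : 0 < e * M 0 by rewrite mulr_gt0.
have [_ [z0 _ <-] hz0] := sup_adherent eM hs.
exists (Num.max z0 0) => z; rewrite ge_max => /andP[z0z zge0].
have h1 : M (z + s) <= sup (range M) by apply: ub_le_sup; [case: hs|exists (z + s)].
have h2 : M z0 <= M z by exact: Mh.
have h3 : e * M 0 <= e * M z by rewrite ler_wpM2l ?(ltW e0)//; exact: Mh.
lra.
Qed.

Lemma slowly_increasing_mgf W : measurable_fun setT W -> (forall w, 0 <= W w) ->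
  (\int[P]_w (expR (W w))%:E < +oo)%E -> slowly_increasing (truncated_mgf W).
Proof.
move=> mW W0 fW; have fin : (\int[P]_w (expR (W w))%:E)%E \is a fin_num.
  by rewrite ge0_fin_numE//; exact: integral_ge0.
apply: (@slowly_increasing_bounded _ (fine (\int[P]_w (expR (W w))%:E)%E)).
- by move=> z; exact: truncated_mgf_gt0.
- by move=> x y xy; exact: le_truncated_mgf.
- move=> z; rewrite -lee_fin truncated_mgfE// fineK//.
  apply: ge0_le_integral => //; [exact: measurable_expR_min|..].
    by apply/measurable_EFinP; exact: measurableT_comp.
  by move=> w _; rewrite lee_fin ler_expR ge_min lexx orbT.
Qed.

(** Monotone convergence along the integer cuts. *)
Lemma truncated_mgf_bounded W (C : R) : measurable_fun setT W ->
  (forall n : nat, truncated_mgf W n%:R <= C) ->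
  (\int[P]_w (expR (W w))%:E < +oo)%E.
Proof.
move=> mW MC; apply: (@le_lt_trans _ _ C%:E); last exact: ltry.
have cv : (fun n : nat => \int[P]_w (expR (Num.min n%:R (W w)))%:E)%E @ \oo -->
    (\int[P]_w (limn (fun n : nat => (expR (Num.min n%:R (W w)))%:E)))%E.
  apply: cvg_monotone_convergence => //.
  - by move=> n; exact: measurable_expR_min.
  - move=> w _ m n mn; rewrite lee_fin ler_expR le_min !ge_min lexx orbT andbT.
    by rewrite ler_nat mn.
rewrite (_ : (\int[P]_w (expR (W w))%:E)%E =
    (\int[P]_w (limn (fun n : nat => (expR (Num.min n%:R (W w)))%:E)))%E); last first.
  apply: eq_integral => w _; apply/esym/cvg_lim => //.
  apply: cvg_near_cst; exists (Num.truncn (W w)).+1 => // n /= Wn.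
  rewrite min_r// ltW// (lt_le_trans (truncnS_gt _))// ler_nat//.
rewrite -(cvg_lim _ cv)//; apply: lime_le; first by apply/cvg_ex; eexists; exact: cv.
by apply: nearW => n; rewrite -truncated_mgfE// lee_fin.
Qed.

(** Raising the cut from [n] to [n + 1] adds at most [(e - 1) e^n e^(-n / c) = (e - 1) q^n] with
    [q = e^(1 - 1/c) < 1], so a geometric series bounds the truncated moments. The case [c = 0],
    where [1/c] makes no sense, is separate. *)
Lemma mgf_exponential E (c : R) : measurable_fun setT E -> (forall w, 0 <= E w) ->
  exponential_tail E -> 0 <= c < 1 -> (\int[P]_w (expR (c * E w))%:E < +oo)%E.
Proof.
move=> mE E0 tE /andP[c0 c1].
have mcE : measurable_fun setT (fun w => c * E w) by exact: measurable_funM.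
move: c0; rewrite le_eqVlt => /predU1P[<-|c0].
  under eq_integral do rewrite mul0r expR0.
  by rewrite integral_cst//= probability_setT mule1 ltry.
pose q := expR (1 - c^-1); pose M := truncated_mgf (fun w => c * E w).
have q0 : 0 < q by exact: expR_gt0.
have q1 : q < 1 by rewrite -expR0 ltr_expR subr_lt0 invf_gt1.
have e1 : 0 <= expR 1 - 1 :> R by have := @expR_ge1Dx R 1; lra.
have step n : M n.+1%:R <= M n%:R + (expR 1 - 1) * q ^+ n.
  rewrite -natr1; apply: (le_trans (truncated_mgfD_le _ mcE ler01)).
  rewrite lerD2l expRD -[X in _ - X]mulr1 -mulrBr mulrAC mulrC ler_wpM2l//.
  rewrite (_ : [set w | _] = [set w | n%:R / c < E w]); last first.
    by apply/seteqP; split => w /=; rewrite ltr_pdivrMr// mulrC.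
  rewrite tE /= /q -expRM_natl -ler_pdivlMl ?expR_gt0//.
  rewrite -expRN -expRD ge_min; apply/orP; right.
  by rewrite ler_expR; lra.
apply: (@truncated_mgf_bounded _ (M 0 + (expR 1 - 1) / (1 - q)) mcE) => n.
apply: (@le_trans _ _ (M 0 + (expR 1 - 1) * (1 - q ^+ n) / (1 - q))).
  elim: n => [|n ih]; first by rewrite subrr mulr0 mul0r addr0.
  apply: (le_trans (step n)); apply: (le_trans (lerD ih (lexx _))).
  rewrite -addrA lerD2l le_eqVlt; apply/orP; left; apply/eqP.
  by rewrite exprS; field; rewrite subr_eq0 gt_eqF.
rewrite lerD2l -[leLHS]mulrA ler_wpM2l// ler_pdivrMr ?subr_gt0// mulVf ?gt_eqF ?subr_gt0//.
by rewrite lerBlDr lerDl exprn_ge0// ltW.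
Qed.

(** From [x / 4 <= e^(x / 4)] follows [x^2 <= 16 e^(x / 2)], and [e^(E / 2)] is integrable. *)
Lemma second_moment_exponential E : measurable_fun setT E -> (forall w, 0 <= E w) ->
  exponential_tail E -> (\int[P]_w (E w ^+ 2)%:E < +oo)%E.
Proof.
move=> mE E0 tE.
have half : 0 <= (2^-1 : R) < 1 by apply/andP; split; lra.
have h := mgf_exponential mE E0 tE half.
have mh : measurable_fun setT (fun w => (expR (2^-1 * E w))%:E).
  apply/measurable_EFinP; apply: measurableT_comp => //; exact: measurable_funM.
apply: (@le_lt_trans _ _ (\int[P]_w (16%:E * (expR (2^-1 * E w))%:E))%E).
  apply: ge0_le_integral => //.
  - by move=> w _; rewrite lee_fin sqr_ge0.
  - by apply/measurable_EFinP; exact: measurable_funX.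
  - exact: measurable_funeM.
  move=> w _; rewrite -EFinM lee_fin.
  have -> : 2^-1 * E w = E w / 4 + E w / 4 by field.
  rewrite expRD; have := @expR_ge1Dx R (E w / 4); have := E0 w.
  move: (E w) (expR _) => x y x0 xy.
  have : (x / 4) ^+ 2 <= y ^+ 2 by rewrite ler_pXn2r ?nnegrE//; lra.
  rewrite !expr2; lra.
rewrite ge0_integralZl//; exact: lte_mul_pinfty.
Qed.

End TruncatedMgf.

(** * Linear combinations of exponential variables *)

Section LinearCombinations.
Context d (T : measurableType d) (R : realType) (P : probability T R).
Context (I : choiceType) (xi : I -> T -> R).
Hypothesis mxi : forall i, measurable_fun setT (xi i).
Hypothesis ixi : independent_family P xi.
Hypothesis xi0 : forall i w, 0 <= xi i w.
Hypothesis txi : forall i, exponential_tail P (xi i).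

Definition lincomb (s : seq I) (c : I -> R) (w : T) : R :=
  \sum_(i <- s) c i * xi i w.

(** Only coordinates of nonzero weight have to lie in [D], so independence can be read off from the
    supports of the coefficients. *)
Lemma measurable_coord_lincomb (D : set I) s c :
  (forall i, i \in s -> c i != 0 -> D i) ->
  measurable_fun [set: g_sigma_algebraType (coord_gen xi D)] (lincomb s c).
Proof.
elim: s => [|i s ih] sD.
  by rewrite (_ : lincomb _ _ = cst 0)//; apply/funext => w; rewrite /lincomb big_nil.
rewrite (_ : lincomb _ _ = (fun w => c i * xi i w) \+ lincomb s c); last first.
  by apply/funext => w; rewrite /lincomb big_cons.
apply: measurable_funD; last first.
  by apply: ih => j js; apply: sD; rewrite inE js orbT.
have [c0|c0] := eqVneq (c i) 0.
  by rewrite c0 (_ : (fun _ => _) = cst 0)//; apply/funext => w; rewrite mul0r.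
apply: measurable_funM => //; apply: measurable_coord; apply: sD => //.
by rewrite inE eqxx.
Qed.

Lemma measurable_lincomb s c : measurable_fun setT (lincomb s c).
Proof.
apply: (measurable_coord_fun mxi (D := setT)).
exact: measurable_coord_lincomb.
Qed.

Lemma lincomb_ge0 s c w : (forall i, i \in s -> 0 <= c i) -> 0 <= lincomb s c w.
Proof.
move=> c0; rewrite /lincomb big_seq; apply: sumr_ge0 => i si.
by rewrite mulr_ge0// c0.
Qed.

Lemma independent_lincomb_coord s c i : i \notin s ->
  independent_rv P (lincomb s c) (xi i).
Proof.
move=> si; apply: (independent_coord_fun mxi ixi (D1 := [set` s]) (D2 := [set i])).
- by apply/seteqP; split => // j [/= js ji]; rewrite -ji js in si.
- by apply: measurable_coord_lincomb.
- exact: measurable_coord.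
Qed.

Lemma independent_rv_comp (X Y : T -> R) (f g : R -> R) :
  measurable_fun setT f -> measurable_fun setT g ->
  independent_rv P X Y -> independent_rv P (f \o X) (g \o Y).
Proof.
move=> mf mg XY A B mA mB.
have mfA : measurable (f @^-1` A) by rewrite -[X in measurable X]setTI; exact: mf.
have mgB : measurable (g @^-1` B) by rewrite -[X in measurable X]setTI; exact: mg.
exact: (XY _ _ mfA mgB).
Qed.

Lemma mgf_lincomb s c : uniq s -> (forall i, i \in s -> 0 <= c i < 1) ->
  (\int[P]_w (expR (lincomb s c w))%:E < +oo)%E.
Proof.
elim: s => [|i s ih] /= us cs.
  under eq_integral do rewrite /lincomb big_nil expR0.
  by rewrite integral_cst//= probability_setT mule1 ltry.
move: us => /andP[si us].
under eq_integral do rewrite /lincomb big_cons addrC -/(lincomb s c _).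
rewrite (@independent_rv_integral_mul _ _ _ P (lincomb s c) (fun w => c i * xi i w)).
- apply: lte_mul_pinfty.
  + exact: integral_ge0.
  + rewrite ge0_fin_numE; last exact: integral_ge0.
    by apply: ih => // j js; apply: cs; rewrite inE js orbT.
  + by apply: mgf_exponential => //; apply: cs; rewrite inE eqxx.
- exact: measurable_lincomb.
- exact: measurable_funM.
- apply: (@independent_rv_comp (lincomb s c) (xi i) idfun (fun x => c i * x)).
  + exact: measurable_id.
  + by apply: measurable_funM.
  exact: independent_lincomb_coord.
Qed.

(** The terms of weight below 1 have a finite exponential moment; those of weight exactly 1 are then
    added one at a time, and each addition preserves slow increase. *)
Lemma slowly_increasing_lincomb s c : uniq s ->
  (forall i, i \in s -> 0 <= c i <= 1) ->
  slowly_increasing (truncated_mgf P (lincomb s c)).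
Proof.
move=> us cs; pose s1 := [seq i <- s | c i < 1].
pose s2 := [seq i <- s | predC (fun i => c i < 1) i].
have c01 i : i \in s1 -> 0 <= c i < 1.
  by rewrite mem_filter => /andP[-> /cs/andP[-> _]].
have c02 i : i \in s2 -> c i = 1.
  by rewrite mem_filter /= -leNgt => /andP[h1 /cs/andP[_ h2]]; apply/le_anti/andP.
have ps : perm_eq s (s2 ++ s1).
  by rewrite perm_sym perm_catC perm_filterC.
have us21 : uniq (s2 ++ s1) by rewrite -(perm_uniq ps).
rewrite (_ : lincomb s c = lincomb (s2 ++ s1) c); last first.
  by apply/funext => w; exact: perm_big.
move: us21 c02; move: s2 {ps} => s2; elim: s2 => [|i s2 ih] /=.
  move=> us1 _; apply: slowly_increasing_mgf.
  - exact: measurable_lincomb.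
  - by move=> w; apply: lincomb_ge0 => i /c01/andP[].
  - exact: mgf_lincomb.
move=> /andP[is21 us21] c1.
rewrite (_ : lincomb _ c = lincomb (s2 ++ s1) c \+ xi i); last first.
  apply/funext => w; rewrite /lincomb big_cons c1 ?inE ?eqxx// mul1r.
  by rewrite addrC.
apply: slowly_increasing_truncated_mgf_add => //.
- exact: measurable_lincomb.
- exact: independent_lincomb_coord.
- move=> w; apply: lincomb_ge0 => j; rewrite mem_cat => /orP[js|/c01/andP[]//].
  by rewrite c1// inE js orbT.
- by apply: ih => // j js; apply: c1; rewrite inE js orbT.
Qed.

End LinearCombinations.

(** * Regular variation on the exponential scale *)

Section SlowlyIncreasing.
Context (R : realType).
Implicit Types M N : R -> R.

Lemma slowly_increasing_scale M (c : R) : 0 < c -> slowly_increasing M ->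
  slowly_increasing (fun z => M (c * z)).
Proof.
move=> c0 [M0 Mh Ms]; split => //.
  by move=> x y xy; apply: Mh; rewrite ler_pM2l.
move=> s e s0 e0; have [z0 h] := Ms (c * s) e (mulr_gt0 c0 s0) e0.
exists (z0 / c) => z; rewrite ler_pdivrMr// mulrC => /h.
by rewrite mulrDr.
Qed.

Lemma slowly_increasing_sqr M : slowly_increasing M ->
  slowly_increasing (fun z => M z ^+ 2).
Proof.
move=> [M0 Mh Ms]; split.
- by move=> z; rewrite exprn_gt0.
- by move=> x y xy; rewrite ler_pXn2r ?nnegrE ?(ltW (M0 _))//; exact: Mh.
move=> s e s0 e0.
(* Since [e' <= 1] and [3 e' <= e], one has [(1 + e')^2 <= 1 + 3 e' <= 1 + e]. *)
pose e' := Num.min 1 (e / 3).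
have e'0 : 0 < e' by rewrite lt_min ltr01 divr_gt0.
have [z0 h] := Ms s e' s0 e'0.
exists z0 => z zz; apply: (@le_trans _ _ ((1 + e') ^+ 2 * M z ^+ 2)).
  rewrite -exprMn ler_pXn2r ?nnegrE ?(ltW (M0 _))//; first exact: h.
  by rewrite mulr_ge0// ?(ltW (M0 _))//; lra.
rewrite ler_wpM2r ?sqr_ge0//.
have h1 : e' <= 1 by rewrite /e' ge_min lexx.
have h2 : e' <= e / 3 by rewrite /e' ge_min lexx orbT.
have : e' * e' <= e' by rewrite ger_pMr.
rewrite expr2; lra.
Qed.

(* [q x] is a quantile of level [1 - 1/x]; [Fbar] may jump, so [Fbar (q x)] need
   not equal [1/x]. *)
Section TailQuantile.
Variables (N1 N2 Fbar g q f : R -> R) (gam : R).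
Hypothesis gam0 : 0 < gam.
Hypothesis sN1 : slowly_increasing N1.
Hypothesis sN2 : slowly_increasing N2.
Hypothesis FbarE : forall z, Fbar z = expR (- z) * N1 z.
Hypothesis gE : forall z, g z = expR (- (gam * z)) * N2 z.
Hypothesis g_ni : {homo g : x y / x <= y >-> y <= x}.
Hypothesis q_lt : forall x z, 1 < x -> z < q x -> x^-1 < Fbar z.
Hypothesis q_gt : forall x z, 1 < x -> q x < z -> Fbar z <= x^-1.
Hypothesis fE : forall x, 1 < x -> f x = g (q x).

Lemma tail_quantile_homo x y : 1 < x -> x <= y -> q x <= q y.
Proof.
move=> x1 xy; rewrite leNgt; apply/negP => qyx.
have [h1 h2] := midf_lt qyx.
have := q_lt x1 h2; have := q_gt (lt_le_trans x1 xy) h1.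
have : y^-1 <= x^-1 by rewrite lef_pV2 ?posrE//; lra.
lra.
Qed.

(** [Fbar B] is positive, and as soon as [1/x < Fbar B] the quantile cannot lie below [B]. *)
Lemma tail_quantile_pinfty (B : R) : exists2 A, 1 < A & forall x, A <= x -> B <= q x.
Proof.
have F0 : 0 < Fbar B by rewrite FbarE mulr_gt0 ?expR_gt0//; case: sN1.
have iF0 : 0 < (Fbar B)^-1 by rewrite invr_gt0.
exists (2 + (Fbar B)^-1) => [|x Ax]; first lra.
rewrite leNgt; apply/negP => qB.
have x1 : 1 < x by lra.
have := q_gt x1 qB; rewrite -[Fbar B]invrK lef_pV2 ?posrE//; last lra.
lra.
Qed.

(** Put [u = q x + e/2], so that [Fbar u <= 1/x]. A further shift by [ln lam + e/2] divides the
    exponential factor by [lam e^(e/2)], while [N1] grows at most by [1 + e/2 <= e^(e/2)]; hence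
    [Fbar] has dropped to [1/(lam x)]. *)
Lemma tail_quantile_shift_le (lam e : R) : 0 < lam -> 0 < e ->
  exists A, forall x, A <= x -> q (lam * x) <= q x + ln lam + e.
Proof.
move=> lam0 e0; pose del := e / 2; have del0 : 0 < del by rewrite divr_gt0.
have [_ Nh Ns] := sN1.
(* The absolute value provides a positive shift also when [lam < 1]; monotonicity of [N1] allows the
   larger shift. *)
have s0 : 0 < `|ln lam| + del by rewrite ltr_wpDl.
have [z0 hz0] := Ns _ _ s0 del0.
have [A A1 hA] := tail_quantile_pinfty z0.
exists (Num.max A (2 / lam)) => x; rewrite ge_max => /andP[Ax lx].
have x1 : 1 < x by lra.
have lx1 : 1 < lam * x.
  by move: lx; rewrite ler_pdivrMr// mulrC; lra.
rewrite leNgt; apply/negP => /(q_lt lx1); apply/negP; rewrite -leNgt.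
set u := q x + del.
have -> : q x + ln lam + e = u + (ln lam + del) by rewrite /u /del; field.
have uq : q x < u by rewrite /u ltrDl.
rewrite FbarE invfM.
apply: (@le_trans _ _ (expR (- (u + (ln lam + del))) * (expR del * N1 u))).
  rewrite ler_wpM2l ?expR_ge0//.
  apply: (@le_trans _ _ (N1 (u + (`|ln lam| + del)))).
    by apply: Nh; rewrite lerD2l lerD2r ler_norm.
  apply: (le_trans (hz0 _ _)); first by have := hA x Ax; rewrite /u; lra.
  by rewrite ler_wpM2r ?expR_ge1Dx//; case: sN1 => N0 _ _; rewrite ltW.
rewrite mulrA -expRD (_ : - _ + del = - ln lam + - u); last by ring.
rewrite expRD expRN lnK ?posrE// -mulrA -FbarE ler_wpM2l ?invr_ge0 ?(ltW lam0)//.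
exact: q_gt.
Qed.

(** This is the upper bound for the factor [lam^-1] at the point [lam * x]. *)
Lemma tail_quantile_shift_ge (lam e : R) : 0 < lam -> 0 < e ->
  exists A, forall x, A <= x -> q x + ln lam - e <= q (lam * x).
Proof.
move=> lam0 e0; have ilam0 : 0 < lam^-1 by rewrite invr_gt0.
have [A hA] := tail_quantile_shift_le ilam0 e0.
exists (A / lam) => x; rewrite ler_pdivrMr// mulrC => /hA.
rewrite mulrA mulVf ?gt_eqF// mul1r lnV ?posrE//; lra.
Qed.

Lemma tail_quantile_shift_cvg (lam : R) : 0 < lam ->
  q (lam * x) - q x @[x --> +oo] --> ln lam.
Proof.
move=> lam0; apply/cvgrPdist_le => e e0.
have [A hA] := tail_quantile_shift_le lam0 e0.
have [B hB] := tail_quantile_shift_ge lam0 e0.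
exists (Num.max A B); split; first exact: num_real.
move=> x; rewrite gt_max => /andP[/ltW/hA h1 /ltW/hB h2].
by rewrite ler_norml; apply/andP; split; lra.
Qed.

(** Eventually the two quantiles are at most [|ln lam| + 1] apart, so each value of [N2] is at most
    [1 + e] times the other. *)
Lemma slowly_increasing_ratio_cvg (lam : R) : 0 < lam ->
  N2 (q (lam * x)) / N2 (q x) @[x --> +oo] --> (1 : R).
Proof.
move=> lam0; apply/cvgrPdist_le => e e0.
have [N0 Nh Ns] := sN2.
have s0 : 0 < `|ln lam| + 1 by rewrite ltr_wpDl.
have [z0 hz0] := Ns _ _ s0 e0.
have [A hA] := tail_quantile_shift_le lam0 ltr01.
have [B hB] := tail_quantile_shift_ge lam0 ltr01.
have [C C1 hC] := tail_quantile_pinfty z0.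
exists (Num.max (Num.max A B) (Num.max C (C / lam))); split; first exact: num_real.
move=> x; rewrite !gt_max => /andP[/andP[/ltW/hA h1 /ltW/hB h2] /andP[Cx Clx]].
have h3 := hC x (ltW Cx).
have h4 : z0 <= q (lam * x) by apply: hC; rewrite ltW// mulrC -ltr_pdivrMr.
have l1 := ler_norm (ln lam); have l2 := ler_norm (- ln lam); rewrite normrN in l2.
have k1 : N2 (q (lam * x)) <= (1 + e) * N2 (q x).
  by apply: le_trans (hz0 _ h3); apply: Nh; lra.
have k2 : N2 (q x) <= (1 + e) * N2 (q (lam * x)).
  by apply: le_trans (hz0 _ h4); apply: Nh; lra.
rewrite ler_norml; apply/andP; split.
  by rewrite lerBrDr addrC -lerBrDr opprK ler_pdivrMr.
rewrite lerBlDr -lerBlDl ler_pdivlMr//.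
(* For [e >= 1] the lower bound is trivial by positivity; for [e < 1] it uses
   [(1 - e) (1 + e) <= 1]. *)
have [e1|e1] := leP 1 e.
  apply: (@le_trans _ _ 0); last exact: ltW.
  by rewrite mulr_le0_ge0 ?subr_le0// ltW.
apply: (@le_trans _ _ ((1 - e) * ((1 + e) * N2 (q (lam * x))))).
  by rewrite ler_wpM2l// subr_ge0 ltW.
have : 0 <= e * e * N2 (q (lam * x)) by rewrite !mulr_ge0// ?(ltW e0) ?(ltW (N0 _)).
lra.
Qed.

(** The ratio of [f] splits into [e^(- gam (q(lam x) - q x))], with limit [lam^(- gam)], and a ratio
    of values of [N2], with limit 1. *)
Lemma regularly_varying_tail_quantile : regularly_varying f (- gam).
Proof.
have g0 z : 0 < g z by rewrite gE mulr_gt0 ?expR_gt0//; case: sN2.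
split.
  exists 2; split; last by move=> x x2; rewrite fE//; lra.
  (* Cutting the argument at 2 makes the composite monotone on the whole line, hence measurable. *)
  refine (eq_measurable_fun (fun x : R => g (q (Num.max 2 x))) _ _).
    move=> x; rewrite inE /= in_itv /= andbT => x2.
    by rewrite fE ?(max_r (ltW x2))//; lra.
  apply: measurable_realfun.nonincreasing_measurable => // x y xy.
  apply: g_ni; apply: tail_quantile_homo; first by rewrite lt_max ltr1n.
  by rewrite ge_max !le_max lexx xy orbT.
move=> lam lam0.
have -> : lam `^ (- gam) = expR (- (gam * ln lam)) * 1.
  by rewrite /powR gt_eqF// mulr1 mulNr.
apply: (@cvg_trans _ ((fun x => expR (- (gam * (q (lam * x) - q x))) *
    (N2 (q (lam * x)) / N2 (q x))) @ +oo)); last first.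
  apply: cvgM; last exact: slowly_increasing_ratio_cvg.
  apply: (@cvg_comp _ _ _ (fun x => - (gam * (q (lam * x) - q x))) expR).
    apply: cvgN; apply: cvgM; first exact: cvg_cst.
    exact: tail_quantile_shift_cvg.
  exact: continuous_expR.
apply: near_eq_cvg; exists (1 + lam^-1); split; first exact: num_real.
move=> x xl /=; have il0 : 0 < lam^-1 by rewrite invr_gt0.
have x1 : 1 < x by lra.
have lx1 : 1 < lam * x.
  have : lam * lam^-1 < lam * x by rewrite ltr_pM2l//; lra.
  by rewrite mulfV// gt_eqF.
rewrite !fE// !gE invfM -expRN opprK mulrACA -expRD.
by congr (expR _ * _); ring.
Qed.

End TailQuantile.
End SlowlyIncreasing.

(** * From tails of the logarithm to the coefficient of tail dependence *)

Section ExponentialScale.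
Context d (T : measurableType d) (R : realType) (P : probability T R).

Lemma cdf_expR (Y : {RV P >-> R}) (S : T -> R) (Fbar : R -> R) (y : R) :
  (forall w, Y w = expR (S w)) -> measurable_fun setT S ->
  (forall z, P [set w | z < S w] = (Fbar z)%:E) ->
  cdf Y y = (if 0 < y then 1 - Fbar (ln y) else 0)%:E.
Proof.
move=> YE mS tS; have eq1 : cdf Y y = P [set w | Y w <= y].
  by rewrite /cdf /distribution /pushforward; congr (P _); apply/seteqP; split => w /=; rewrite in_itv.
rewrite eq1; have [y0|y0] := ltP 0 y.
  rewrite EFinB -tS -probability_setC; last exact: measurable_gt.
  congr (P _); apply/seteqP; split => w /=; rewrite YE.
    by move=> h; apply/negP; rewrite -leNgt -ler_expR lnK ?posrE.
  by move=> /negP; rewrite -leNgt => h; rewrite -[leRHS]lnK ?posrE// ler_expR.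
rewrite (_ : [set w | _] = set0) ?measure0//; apply/seteqP; split => // w /=.
by rewrite YE leNgt (le_lt_trans y0 (expR_gt0 _)).
Qed.

(** The logarithm of the marginal quantile of level [1 - 1/x] serves as [q x]. Because [S0 >= 0],
    this quantile is at least 1 for [x > 1], so its logarithm is meaningful. *)
Lemma coef_tail_dependence_expR (Y0 Y1 : {RV P >-> R}) (S0 S1 : T -> R)
    (N1 N2 Fbar g : R -> R) (gam : R) :
  (forall w, Y0 w = expR (S0 w)) -> (forall w, Y1 w = expR (S1 w)) ->
  measurable_fun setT S0 -> measurable_fun setT S1 ->
  (forall w, 0 <= S0 w) ->
  (forall z, P [set w | z < S0 w] = (Fbar z)%:E) ->
  (forall z, P [set w | z < S1 w] = (Fbar z)%:E) ->
  (forall z, P [set w | z < S0 w /\ z < S1 w] = (g z)%:E) ->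
  slowly_increasing N1 -> slowly_increasing N2 -> 0 < gam ->
  (forall z, Fbar z = expR (- z) * N1 z) ->
  (forall z, g z = expR (- (gam * z)) * N2 z) ->
  coef_tail_dependence Y0 Y1 gam^-1.
Proof.
move=> Y0E Y1E mS0 mS1 S00 tS0 tS1 tS01 sN1 sN2 gam0 FbarE gE.
have cdfE y := cdf_expR y Y0E mS0 tS0.
have quantileE p : quantile Y0 p = quantile Y1 p.
  rewrite /quantile; congr (ereal_inf (_ @` _)).
  by apply/seteqP; split => y /=; rewrite cdfE (cdf_expR y Y1E mS1 tS1).
pose E (x : R) := [set y : R | ((1 - x^-1)%:E <= cdf Y0 y)%E].
have E_up x y z : E x y -> y <= z -> E x z.
  by move=> Exy yz; apply: (le_trans Exy); exact: cdf_nondecreasing.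
have Fbar1 z : z < 0 -> Fbar z = 1.
  move=> z0; apply: EFin_inj; rewrite -tS0 -(@probability_setT _ _ _ P).
  by congr (P _); apply/seteqP; split => // w _ /=; exact: lt_le_trans z0 _.
(* Below 1 the distribution function is 0, which is less than [1 - 1/x]. *)
have E_lb x : 1 < x -> lbound (E x) 1.
  move=> x1 y; rewrite /E /= cdfE lee_fin => h; rewrite leNgt; apply/negP => y1.
  have : x^-1 < 1 by rewrite invf_lt1//; lra.
  by move: h; case: ifPn => y0; [rewrite Fbar1 ?ln_lt0 ?y0|]; lra.
(* If the set were empty, the distribution function would stay below [1 - 1/x], against its limit
   1. *)
have E0 x : 1 < x -> E x !=set0.
  move=> x1; have ix0 : 0 < x^-1 by rewrite invr_gt0; lra.
  have lt1 : ((1 - x^-1)%:E < 1%:E)%E by rewrite lte_fin; lra.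
  apply/set0P/negP => /eqP E0; move: lt1; apply/negP; rewrite -leNgt.
  apply: cvge_le (cvg_cdfy1 Y0); apply: nearW => y.
  by rewrite leNgt; apply/negP => /ltW yE; have : E x y by []; rewrite E0.
pose r x := inf (E x).
have rE x : 1 < x -> quantile Y0 (1 - x^-1) = (r x)%:E.
  move=> x1; rewrite /quantile -/(E x); apply: ereal_inf_EFin; last exact: E0.
  by exists 1; exact: E_lb.
have r1 x : 1 < x -> 1 <= r x.
  by move=> x1; apply: lb_le_inf; [exact: E0|exact: E_lb].
have r0 x : 1 < x -> 0 < r x by move=> /r1; exact: lt_le_trans.
split.
- by move=> p _; exact: quantileE.
- by rewrite invr_eq0 gt_eqF.
rewrite invrK.
apply: (@regularly_varying_tail_quantile _ N1 N2 Fbar g (fun x => ln (r x))) => //.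
- move=> x y xy; rewrite -lee_fin -!tS01; apply: le_measure; rewrite ?inE.
  + by apply: measurableI; exact: measurable_gt.
  + by apply: measurableI; exact: measurable_gt.
  + by move=> w /= [h1 h2]; split; exact: le_lt_trans xy _.
- move=> x z x1; rewrite -ltr_expR lnK ?posrE ?r0// => zr.
  rewrite ltNge; apply/negP => Fz.
  have : E x (expR z) by rewrite /E /= cdfE expR_gt0 expRK lee_fin; lra.
  move=> /(ge_inf (ex_intro _ 1 (E_lb x x1))).
  by rewrite leNgt zr.
- move=> x z x1; rewrite -ltr_expR lnK ?posrE ?r0// => rz.
  have rz0 : 0 < expR z - r x by rewrite subr_gt0.
  have [y Ey] := inf_adherent rz0 (conj (E0 x x1) (ex_intro _ 1 (E_lb x x1))).
  rewrite -/(r x) addrC subrK => yz.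
  have := E_up _ _ _ Ey (ltW yz).
  by rewrite /E /= cdfE expR_gt0 expRK lee_fin; lra.
- move=> x x1; rewrite /joint_exceedance -quantileE rE//.
  rewrite (_ : [set w | _] = [set w | ln (r x) < S0 w /\ ln (r x) < S1 w]) ?tS01//.
  have e w S : (r x < expR (S w)) = (ln (r x) < S w :> R).
    by rewrite -[in RHS]ltr_expR lnK ?posrE ?r0.
  by apply/seteqP; split => w /=; rewrite !lte_fin Y0E Y1E !e.
Qed.

End ExponentialScale.

(** * Joint tails and moving averages *)

Section JointTails.
Context d (T : measurableType d) (R : realType) (P : probability T R).
Context (I : choiceType) (xi : I -> T -> R).
Hypothesis mxi : forall i, measurable_fun setT (xi i).
Hypothesis ixi : independent_family P xi.
Hypothesis xi0 : forall i w, 0 <= xi i w.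
Hypothesis txi : forall i, exponential_tail P (xi i).

Lemma joint_tail_disjoint s (c c' : I -> R) (z : R) :
  (forall i, i \in s -> c i != 0 -> c' i = 0) ->
  P [set w | z < lincomb xi s c w /\ z < lincomb xi s c' w] =
  (P [set w | (z < lincomb xi s c w)%R] * P [set w | (z < lincomb xi s c' w)%R])%E.
Proof.
move=> cc'.
have ind : independent_rv P (lincomb xi s c) (lincomb xi s c').
  apply: (independent_coord_fun mxi ixi (D1 := [set i | i \in s /\ c i != 0])
    (D2 := [set i | i \in s /\ c' i != 0])).
  - by apply/seteqP; split => // i [/= [si ci] [_ /eqP]]; rewrite cc'.
  - by apply: measurable_coord_lincomb.
  - by apply: measurable_coord_lincomb.
have e (X : T -> R) : [set w | z < X w] = X @^-1` `]z, +oo[%classic.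
  by apply/seteqP; split => w /=; rewrite in_itv /= andbT.
have -> : [set w | z < lincomb xi s c w /\ z < lincomb xi s c' w] =
  [set w | z < lincomb xi s c w] `&` [set w | z < lincomb xi s c' w] by [].
by rewrite !e; apply: ind; exact: measurable_itv.
Qed.

Lemma joint_tail_shared s (c c' : I -> R) (i0 : I) (tau : R) : uniq s -> i0 \in s ->
  2^-1 < tau -> c i0 = tau -> c' i0 = tau ->
  (forall i, i \in s -> i != i0 -> [/\ 0 <= c i, 0 <= c' i & c i + c' i <= 1]) ->
  exists N : R -> R, slowly_increasing N /\
    forall z, P [set w | z < lincomb xi s c w /\ z < lincomb xi s c' w] =
      (expR (- (tau^-1 * z)) * N z)%:E.
Proof.
move=> us si0 tau2 ci0 c'i0 cs; have tau0 : 0 < tau by lra.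
have itau0 : 0 < tau^-1 by rewrite invr_gt0.
pose s' := rem i0 s.
have s's i : i \in s' -> i \in s /\ i != i0.
  by rewrite mem_rem_uniq// inE => /andP[].
have s'i0 : i0 \notin s' by rewrite mem_rem_uniq// inE eqxx.
have us' : uniq s' by rewrite rem_uniq.
have split_ b w : lincomb xi s b w = b i0 * xi i0 w + lincomb xi s' b w.
  by rewrite /lincomb (perm_big _ (perm_to_rem si0)) big_cons.
(* With the shared term [tau * xi i0] split off, both combinations exceed [z] exactly when
   [W + xi i0] exceeds [z / tau]. *)
pose W w := tau^-1 * Num.min (lincomb xi s' c w) (lincomb xi s' c' w).
have mWD : measurable_fun [set: g_sigma_algebraType (coord_gen xi [set` s'])] W.
  by apply: measurable_funM => //; apply: measurable_minr; exact: measurable_coord_lincomb.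
have mW : measurable_fun setT W by exact: (measurable_coord_fun mxi mWD).
have W0 w : 0 <= W w.
  rewrite mulr_ge0 ?(ltW itau0)// le_min !lincomb_ge0// => i /s's[is_ ii0].
    by have [] := cs i is_ ii0.
  by have [] := cs i is_ ii0.
have iW : independent_rv P W (xi i0).
  apply: (independent_coord_fun mxi ixi (D1 := [set` s']) (D2 := [set i0])) => //.
  - by apply/seteqP; split => // j [/= js ji]; rewrite -ji js in s'i0.
  - exact: measurable_coord.
(* These weights of the averaged combination are at most [1 / (2 tau)], which is below 1 since
   [tau > 1/2]. *)
pose e i := tau^-1 / 2 * (c i + c' i).
have We w : W w <= lincomb xi s' e w.
  have -> : lincomb xi s' e w = tau^-1 * ((lincomb xi s' c w + lincomb xi s' c' w) / 2).
    rewrite /lincomb -big_split /= mulr_suml mulr_sumr; apply: eq_bigr => i _.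
    by rewrite /e; field; rewrite gt_eqF.
  rewrite ler_wpM2l ?(ltW itau0)//.
  have h1 : Num.min (lincomb xi s' c w) (lincomb xi s' c' w) <= lincomb xi s' c w.
    by rewrite ge_min lexx.
  have h2 : Num.min (lincomb xi s' c w) (lincomb xi s' c' w) <= lincomb xi s' c' w.
    by rewrite ge_min lexx orbT.
  lra.
have itau2 : tau^-1 < 2 by rewrite invf_plt ?posrE.
have fW : (\int[P]_w (expR (W w))%:E < +oo)%E.
  apply: (@le_lt_trans _ _ (\int[P]_w (expR (lincomb xi s' e w))%:E)%E).
    apply: ge0_le_integral => //.
    - by apply/measurable_EFinP; exact: measurableT_comp.
    - apply/measurable_EFinP; apply: measurableT_comp => //.
      exact: measurable_lincomb.
    - by move=> w _; rewrite lee_fin ler_expR.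
  apply: mgf_lincomb => // i /s's[is_ ii0].
  have [h1 h2 h3] := cs i is_ ii0.
  rewrite /e; apply/andP; split.
    by rewrite mulr_ge0 ?addr_ge0// divr_ge0// ltW.
  apply: (@le_lt_trans _ _ (tau^-1 / 2)); last lra.
  by rewrite ger_pMr// divr_gt0.
exists (fun z => truncated_mgf P W (tau^-1 * z)); split.
  apply: slowly_increasing_scale => //; exact: slowly_increasing_mgf.
move=> z; rewrite -(@tail_add_exponential _ _ _ _ W (xi i0))//.
congr (P _); apply/seteqP; split => w /=; rewrite !split_ ci0 c'i0.
  move=> [h1 h2]; rewrite -[X in _ < _ + X](mulKf (lt0r_neq0 tau0)) -mulrDr.
  rewrite ltr_pM2l// -ltrBlDr lt_min; apply/andP; split; lra.
rewrite -[X in _ < _ + X](mulKf (lt0r_neq0 tau0)) -mulrDr.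
by rewrite ltr_pM2l// -ltrBlDr lt_min => /andP[h1 h2]; split; lra.
Qed.

End JointTails.

(** * Finite moving averages of exponential innovations *)

Section MovingAverage.
Context d (T : measurableType d) (R : realType) (P : probability T R).
Context (xi : int -> T -> R).
Hypothesis mxi : forall i, measurable_fun setT (xi i).
Hypothesis ixi : independent_family P xi.
Hypothesis xi0 : forall i w, 0 <= xi i w.
Hypothesis txi : forall i, exponential_tail P (xi i).
Hypothesis idxi : forall i j (A : set R), measurable A ->
  P (xi i @^-1` A) = P (xi j @^-1` A).
Context (a : nat -> R) (N : nat).

(** Taking a path as argument turns a time shift of the process into a shift of the path. *)
Definition moving_average (p : int -> R) (t : int) : R :=
  \sum_(i <- iota 0 N) a i * p (t - i%:Z).

Lemma measurable_moving_average d' (X : measurableType d') (f : int -> X -> R) t :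
  (forall j, measurable_fun setT (f j)) ->
  measurable_fun setT (fun x => moving_average (f ^~ x) t).
Proof.
move=> mf; apply: measurable_sum => i; exact: measurable_funM.
Qed.

Lemma moving_average_shift p t k :
  moving_average p (t + k) = moving_average (fun j => p (j + k)) t.
Proof. by apply: eq_bigr => i _; rewrite addrAC. Qed.

Lemma path_law_shift (C : set (int -> R)) (k : int) : <<s @path_gen R int >> C ->
  P [set w | C (fun j => xi (j + k) w)] = P [set w | C (xi ^~ w)].
Proof.
move=> mC; apply: (@path_law _ _ _ P _ (fun j => xi (j + k)) xi) => //.
  exact: (@independent_family_inj _ _ _ P _ _ (fun j => j + k) xi (@addIr _ k)).
by move=> i A mA; exact: idxi.
Qed.

Lemma measurable_path_moving_average t :
  measurable_fun [set: g_sigma_algebraType (@path_gen R int)]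
    (fun p => moving_average p t).
Proof.
apply: (@measurable_moving_average _ (g_sigma_algebraType (@path_gen R int))
  (fun i p => p i)) => j.
exact: (@measurable_coord R _ _ (fun i (p : int -> R) => p i) setT j Logic.I).
Qed.

(** Both entries of a pair agree because the noise is 1. The event is a measurable set of paths, and
    the path law is invariant under shifts. *)
Lemma exp_moving_average_stationary (n : nat) (t : 'I_n -> int) (k : int)
    (B : set (n.-tuple (R * R)%type)) : measurable B ->
  P [set w | B [tuple (expR (moving_average (xi ^~ w) (t i + k)),
                       expR (moving_average (xi ^~ w) (t i + k))) | i < n]] =
  P [set w | B [tuple (expR (moving_average (xi ^~ w) (t i)),
                       expR (moving_average (xi ^~ w) (t i))) | i < n]].
Proof.
move=> mB.
pose F (p : int -> R) := [tuple (expR (moving_average p (t i)),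
                       expR (moving_average p (t i))) | i < n].
have mF : measurable_fun [set: g_sigma_algebraType (@path_gen R int)] F.
  apply/measurable_fun_tnthP => i.
  rewrite (_ : _ \o F = fun p => (expR (moving_average p (t i)), expR (moving_average p (t i)))).
    by apply: measurable_fun_pair; apply: measurableT_comp => //;
      exact: measurable_path_moving_average.
  by apply/funext => p /=; rewrite /F tnth_mktuple.
have mC : <<s @path_gen R int >> [set p | B (F p)].
  by have := mF measurableT _ mB; rewrite setTI.
have := path_law_shift k mC; rewrite /F /= => <-; congr (P _).
apply: eq_set => w; congr (B _); apply: eq_from_tnth => i.
by rewrite !tnth_mktuple moving_average_shift.
Qed.

Lemma moving_average_tail_shift t (z : R) :
  P [set w | z < moving_average (xi ^~ w) t] =
  P [set w | z < moving_average (xi ^~ w) 0].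
Proof.
have mC : <<s @path_gen R int >> [set p | z < moving_average p 0].
  have : measurable [set p : g_sigma_algebraType (@path_gen R int) | z < moving_average p 0].
    apply: measurable_gt; exact: measurable_path_moving_average.
  by [].
have := path_law_shift t mC => /= <-; congr (P _).
by apply: eq_set => w; rewrite -{1}[t]add0r moving_average_shift.
Qed.

Hypothesis a01 : forall i, 0 <= a i <= 1.
Hypothesis aN : forall i, (N <= i)%N -> a i = 0.

Lemma moving_average_lincomb t w :
  moving_average (xi ^~ w) t = lincomb (fun i => xi (t - i%:Z)) (iota 0 N) a w.
Proof. by []. Qed.

Lemma subz_inj (t : int) : injective (fun i : nat => t - i%:Z).
Proof. by move=> i j /addrI/oppr_inj[]. Qed.

Lemma independent_reversed t : independent_family P (fun i : nat => xi (t - i%:Z)).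
Proof.
exact: (@independent_family_inj _ _ _ P _ _ (fun i : nat => t - i%:Z) xi (@subz_inj t)).
Qed.

Lemma moving_average_ge0 t w : 0 <= moving_average (xi ^~ w) t.
Proof.
by apply: sumr_ge0 => i _; rewrite mulr_ge0//; have /andP[] := a01 i.
Qed.

(** The innovation of weight [a 0 = 1] is the exponential summand of [tail_add_exponential]; the
    other terms form [W]. *)
Lemma moving_average_tail : (0 < N)%N -> a 0%N = 1 ->
  exists M : R -> R, slowly_increasing M /\
    forall t z, P [set w | z < moving_average (xi ^~ w) t] = (expR (- z) * M z)%:E.
Proof.
move=> N0 a0; pose ze (i : nat) := xi (0 - i%:Z).
have mze i : measurable_fun setT (ze i) by exact: mxi.
have ize : independent_family P ze by exact: independent_reversed.
exists (truncated_mgf P (lincomb ze (iota 1 N.-1) a)); split.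
  apply: slowly_increasing_lincomb => //; [by move=> *; exact: xi0|by move=> *; exact: txi|exact: iota_uniq].
move=> t z; rewrite moving_average_tail_shift.
rewrite -(@tail_add_exponential _ _ _ _ (lincomb ze (iota 1 N.-1) a) (ze 0%N)) //.
- congr (P _); apply: eq_set => w; rewrite moving_average_lincomb.
  rewrite -[N in LHS]prednK//= /lincomb big_cons a0 mul1r.
  by rewrite addrC.
- exact: measurable_lincomb.
- apply: independent_lincomb_coord => //.
  by rewrite mem_iota ltnn.
- exact: txi.
Qed.

(** Counting innovations backwards from time [h] puts both variables over one list: the coefficients
    at time 0 are delayed by [h], those at time [h] are padded with zeros. *)
Lemma joint_moving_average (h : nat) w :
  let b j := if (j < h)%N then 0 else a (j - h)%N in
  let ze (j : nat) := xi (h%:Z - j%:Z) in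
  moving_average (xi ^~ w) 0 = lincomb ze (iota 0 (h + N)) b w /\
  moving_average (xi ^~ w) h%:Z = lincomb ze (iota 0 (h + N)) a w.
Proof.
move=> b ze; split; rewrite moving_average_lincomb /lincomb.
  rewrite iotaD big_cat /= add0n [X in _ = X + _]big_seq [X in _ = X + _]big1 ?add0r; last first.
    by move=> j; rewrite mem_iota /= add0n => jh; rewrite /b jh mul0r.
  rewrite -[h in RHS]addn0 iotaDl big_map; apply: eq_bigr => i _.
  by rewrite /b /ze ltnNge leq_addr /= addKn PoszD opprD addrA subrr.
rewrite addnC iotaD big_cat /= [X in _ + X]big_seq [X in _ + X]big1 ?addr0//.
by move=> j; rewrite mem_iota add0n => /andP[Nj _]; rewrite aN// mul0r.
Qed.

Lemma joint_tail_moving_average_shared (h j0 : nat) (tau : R) :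
  2^-1 < tau -> a j0 = tau -> a (j0 + h)%N = tau ->
  (forall i, a i != 0 -> a (i + h)%N != 0 -> i = j0) ->
  exists N2 : R -> R, slowly_increasing N2 /\
    forall z, P [set w | z < moving_average (xi ^~ w) 0 /\
                         z < moving_average (xi ^~ w) h%:Z] =
      (expR (- (tau^-1 * z)) * N2 z)%:E.
Proof.
move=> tau2 aj0 aj0h ah.
pose b j := if (j < h)%N then 0 else a (j - h)%N.
pose ze (j : nat) := xi (h%:Z - j%:Z).
have j0N : (j0 < N)%N.
  by rewrite ltnNge; apply/negP => /aN; lra.
(* Counted backwards from time [h], the shared innovation has index [j0 + h]. *)
have [||||N2 [sN2 hN2]] := @joint_tail_shared _ _ _ P _ ze (fun=> mxi _) (independent_reversed h%:Z)
  (fun=> xi0 _) (fun=> txi _) (iota 0 (h + N)) b a (j0 + h)%N tau (iota_uniq _ _) _ tau2.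
- by rewrite mem_iota /= add0n addnC ltn_add2l.
- by rewrite /b ltnNge leq_addl /= addnK.
- by [].
- move=> i _ ij0; have /andP[ai0 ai1] := a01 i.
  rewrite /b; case: ifPn => [_|]; first by split => //; rewrite add0r.
  rewrite -leqNgt => hi; have /andP[ai0' ai1'] := a01 (i - h)%N; split => //.
  (* Away from the shared index at most one of the two weights is nonzero, so their sum is at most
     1. *)
  have [->|n0] := eqVneq (a (i - h)%N) 0; first by rewrite add0r.
  have [->|n1] := eqVneq (a i) 0; first by rewrite addr0.
  by have := ah _ n0; rewrite subnK// => /(_ n1) e; rewrite -e subnK// eqxx in ij0.
exists N2; split => // z; rewrite -hN2; congr (P _); apply: eq_set => w.
by have [-> ->] := joint_moving_average h w.
Qed.

Lemma joint_tail_moving_average_disjoint (h : nat) (M : R -> R) :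
  (forall i, a i != 0 -> a (i + h)%N = 0) ->
  slowly_increasing M ->
  (forall t z, P [set w | z < moving_average (xi ^~ w) t] = (expR (- z) * M z)%:E) ->
  exists N2 : R -> R, slowly_increasing N2 /\
    forall z, P [set w | z < moving_average (xi ^~ w) 0 /\
                         z < moving_average (xi ^~ w) h%:Z] =
      (expR (- (2 * z)) * N2 z)%:E.
Proof.
move=> ah sM tM; exists (fun z => M z ^+ 2); split; first exact: slowly_increasing_sqr.
move=> z.
pose b j := if (j < h)%N then 0 else a (j - h)%N.
pose ze (j : nat) := xi (h%:Z - j%:Z).
transitivity (P [set w | (z < moving_average (xi ^~ w) 0)%R] *
              P [set w | (z < moving_average (xi ^~ w) h%:Z)%R])%E; last first.
  by rewrite !tM -EFinM; congr EFin; rewrite mulrACA -expRD expr2; congr (expR _ * _); ring.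
have e0 w : moving_average (xi ^~ w) 0 = lincomb ze (iota 0 (h + N)) b w.
  by have [] := joint_moving_average h w.
have e1 w : moving_average (xi ^~ w) h%:Z = lincomb ze (iota 0 (h + N)) a w.
  by have [] := joint_moving_average h w.
under eq_set do rewrite e0 e1.
under [X in (P X * _)%E]eq_set do rewrite e0.
under [X in (_ * P X)%E]eq_set do rewrite e1.
apply: joint_tail_disjoint.
- by move=> i; exact: mxi.
- exact: independent_reversed.
- move=> i _; rewrite /b; case: ifPn; first by rewrite eqxx.
  by rewrite -leqNgt => hi /ah; rewrite subnK.
Qed.

End MovingAverage.

(** * Coefficients and constant noise *)

Section Coefficients.
Context (R : realType) (m : nat) (t : nat -> R).
Hypothesis t01 : forall q, 0 <= t q <= 1.
Hypothesis t0 : t 0%N = 0.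
Hypothesis tm : forall q, (m < q)%N -> t q = 0.

Let L := m.*2.+1.

(* Writing [i = q L + r], the block of lag [q] occupies [r = 0] and [r = q];
   [t 0 = 0] leaves the positions [0 < i < L] empty. *)
Definition block_coef (i : nat) : R :=
  if i == 0%N then 1
  else if (i %% L == 0)%N || (i %% L == i %/ L)%N then t (i %/ L)%N else 0.

Lemma block_coef01 i : 0 <= block_coef i <= 1.
Proof.
rewrite /block_coef; case: ifP => _; first by rewrite ler01 lexx.
by case: ifP => _; rewrite ?lexx ?ler01 ?t01.
Qed.

Lemma block_coef_support i : (m.+1 * L <= i)%N -> block_coef i = 0.
Proof.
move=> iL; have i0 : (0 < i)%N by apply: leq_trans iL.
rewrite /block_coef gtn_eqF//; case: ifP => // _; apply: tm.
by rewrite leq_divRL.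
Qed.

Lemma block_coef_neq0 i : (0 < i)%N -> block_coef i != 0 ->
  [/\ (0 < i %/ L)%N, (i %/ L <= m)%N & (i %% L == 0)%N || (i %% L == i %/ L)%N].
Proof.
move=> i0; rewrite /block_coef gtn_eqF//; case: ifP => [_ tq|]; last by rewrite eqxx.
split => //.
  by rewrite lt0n; apply: contra tq => /eqP ->; rewrite t0.
by rewrite leqNgt; apply: contra tq => /tm ->.
Qed.

(** Remainder and lag are at most [m] and [L > 2 m], so [i] and [i + h] have the same quotient [q].
    From remainder [q] the lag leads to [q + h], an empty position; from remainder 0 it leads to
    [h], which forces [h = q]. For [i = 0] the quotient of [h] would be 0. *)
Lemma block_coef_lag h i : (0 < h <= m)%N ->
  block_coef i != 0 -> block_coef (i + h) != 0 -> i = (h * L)%N.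
Proof.
move=> /andP[h0 hm] ai aih.
have ih0 : (0 < i + h)%N by rewrite addn_gt0 h0 orbT.
have [p1 p2 p3] := block_coef_neq0 ih0 aih.
have [i0|i0] := posnP i.
  by move: p1; rewrite i0 add0n divn_small// /L; lia.
have [q1 q2 q3] := block_coef_neq0 i0 ai.
have rm : (i %% L <= m)%N by case/orP: q3 => /eqP ->.
have e : (i + h)%N = (i %/ L * L + (i %% L + h))%N by rewrite addnA -divn_eq.
have rh : (i %% L + h < L)%N by rewrite ltnS -addnn leq_add.
move: p3; rewrite e modnMDl divnMDl// (modn_small rh) (divn_small rh) addn0.
move: q3 => /orP[/eqP r0|/eqP rq]; last by rewrite rq; lia.
rewrite r0 add0n gtn_eqF//= => /eqP ->.
by rewrite [LHS](divn_eq i L) r0 addn0.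
Qed.

Lemma block_coef_first h : (0 < h <= m)%N -> block_coef (h * L) = t h.
Proof.
move=> /andP[h0 hm]; rewrite /block_coef muln_eq0 gtn_eqF//=.
by rewrite modnMl eqxx mulnK.
Qed.

Lemma block_coef_second h : (0 < h <= m)%N -> block_coef (h * L + h) = t h.
Proof.
move=> /andP[h0 hm]; have hL : (h < L)%N by rewrite /L; lia.
rewrite /block_coef addn_eq0 muln_eq0 !(gtn_eqF h0) andbF /=.
by rewrite modnMDl divnMDl// modn_small// divn_small// addn0 eqxx orbT.
Qed.

End Coefficients.

Definition rv_of d (T : measurableType d) (R : realType) (P : probability T R)
    (f : T -> R) (mf : measurable_fun setT f) : {RV P >-> R} :=
  HB.pack f (isMeasurableFun.Build _ _ _ _ f mf).

Section ConstantNoise.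
Context d (T : measurableType d) (R : realType) (P : probability T R).

Definition unit_noise (_ : int) : {RV P >-> R} :=
  (cst (1 : R) : {mfun T >-> R}).

Lemma unit_noise_multiplicative : multiplicative_noise unit_noise.
Proof.
have pre t (A : set R) : unit_noise t @^-1` A = if 1 \in A then setT else set0.
  by rewrite /unit_noise /= preimage_cst.
split.
- split; last by move=> t A mA.
  move=> s A us mA; elim: s us => [|i s ih] /=; first by rewrite !big_nil probability_setT.
  move=> /andP[_ us]; rewrite !big_cons -ih// (pre i (A i)); case: (1 \in A i).
    by rewrite setTI probability_setT mul1e.
  by rewrite set0I measure0 mul0e.
- rewrite (_ : [set w | _] = setT) ?probability_setT//.
  by apply/seteqP; split => // w _ /=; exact: ltr01.
- exists 1; split => //.
  rewrite unlock; under eq_integral do rewrite /= normr1 powR1.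
  by rewrite integral_cst//= probability_setT mul1e ltry.
Qed.

(** A constant process generates only the trivial sigma-algebra. *)
Lemma independent_unit_noise (xi : int -> {RV P >-> R}) :
  independent_processes xi unit_noise.
Proof.
move=> A B sA sB.
have : B = set0 \/ B = setT.
  have sub : sigma_of unit_noise `<=` [set B | B = set0 \/ B = setT].
    apply: smallest_sub.
      split => [|C|F hF]; first by left.
        by move=> [->|->]; rewrite ?setD0 ?setDv; [right|left].
      have [[i Fi]|nF] := pselect (exists i, F i = setT).
        by right; apply/seteqP; split => // x _; exists i => //; rewrite Fi.
      left; apply/seteqP; split => // x [i _ Fix].
      by case: (hF i) => e; [rewrite e in Fix|case: nF; exists i].
    move=> _ [t _ [C mC <-]]; rewrite setTI /unit_noise /= preimage_cst.
    by case: ifP => _; [right|left].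
  exact: sub sB.
move=> [->|->]; first by rewrite setI0 measure0 mule0.
by rewrite setIT probability_setT mule1.
Qed.

End ConstantNoise.

(** * Construction of the model for prescribed coefficients *)

Theorem theorem5p4 (R : realType) (m : nat) (hm : (0 < m)%N) (eta : 'rV[R]_m)
    (heta : forall h : 'I_m, 2^-1 <= eta ord0 h <= 1) :
  exists (d : measure_display) (T : measurableType d) (P : probability T R)
    (X sigma : int -> {RV P >-> R}),
    gamma_SV_model X sigma /\
    forall h : 'I_m,
      coef_tail_dependence (sigma 0) (sigma (h.+1)%:Z) (eta ord0 h) /\
      coef_tail_dependence (X 0) (X (h.+1)%:Z) (eta ord0 h).
Proof.
pose P : probability (measurableTypeR R) R := uniform_prob (@ltr01 R).
have [xi0 [mxi ixi xi_ge0 txi idxi]] := exists_iid_exponential R int.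
pose xi (j : int) : {RV P >-> R} := rv_of P (mxi j).
(* Lag [h] corresponds to the ordinal [h - 1]. The weight is 0 at lag 0, beyond [m], and where the
   prescribed coefficient is 1/2. *)
pose t (q : nat) : R := if q is q'.+1 then
  (if insub q' is Some h then (if 2^-1 < eta ord0 h then eta ord0 h else 0) else 0) else 0.
have th (h : 'I_m) : t h.+1 = if 2^-1 < eta ord0 h then eta ord0 h else 0.
  by rewrite /t valK.
have t01 q : 0 <= t q <= 1.
  case: q => [|q] /=; first by rewrite lexx ler01.
  case: insub => [h|]; last by rewrite lexx ler01.
  have /andP[h1 h2] := heta h.
  by case: ifP => _; rewrite ?lexx ?ler01// h2 andbT; lra.
have tm q : (m < q)%N -> t q = 0.
  by case: q => // q mq; rewrite /t insubN// -leqNgt.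
have t0 : t 0%N = 0 by [].
pose a := block_coef m t; pose N := (m.+1 * m.*2.+1)%N.
have a01 i : 0 <= a i <= 1  := @block_coef01 R m t t01 i.
have aN i : (N <= i)%N -> a i = 0 := @block_coef_support R m t tm i.
have a0 : a 0%N = 1 by [].
have N0 : (0 < N)%N by [].
pose S (j : int) (w : measurableTypeR R) := moving_average a N (xi0 ^~ w) j.
have mS j : measurable_fun setT (S j) by exact: measurable_moving_average.
have S0 j w : 0 <= S j w by exact: moving_average_ge0.
have mexpS j : measurable_fun setT (fun w => expR (S j w)) by exact: measurableT_comp.
pose sigma (j : int) : {RV P >-> R} := rv_of P (mexpS j).
exists _, _, P, sigma, sigma; split; last first.
  have [M [sM tM]] := moving_average_tail (T := measurableTypeR R) (P := P) mxi ixi xi_ge0 txi idxi a01 N0 a0.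
  suff main (h : 'I_m) : exists gam N2, [/\ eta ord0 h = gam^-1, 0 < gam,
      slowly_increasing N2 & forall z, P [set w | z < S 0 w /\ z < S h.+1%:Z w] =
        (expR (- (gam * z)) * N2 z)%:E].
    move=> h; have [gam [N2 [-> gam0 sN2 gE]]] := main h.
    have dep : coef_tail_dependence (sigma 0) (sigma h.+1%:Z) gam^-1.
      exact: (@coef_tail_dependence_expR _ _ _ P (sigma 0) (sigma h.+1%:Z) (S 0)
        (S h.+1%:Z) M N2 _ _ gam (fun=> erefl) (fun=> erefl) (mS _) (mS _) (S0 _)
        (tM _) (tM _) gE sM sN2 gam0 (fun=> erefl) (fun=> erefl)).
    by split.
  have hm1 : (0 < h.+1 <= m)%N by rewrite ltn_ord.
  have /andP[+ _] := heta h; rewrite le_eqVlt => /predU1P[etaE|eta_gt].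
    have [|N2 [sN2 hN2]] := joint_tail_moving_average_disjoint (T := measurableTypeR R) (P := P) mxi ixi aN (h := h.+1) _ sM tM.
      move=> i ai; apply/eqP/negPn/negP => aih.
      (* Two nonzero weights at distance [h] could only start at [h L], where the weight is 0 in
         this case. *)
      have iE := @block_coef_lag R m t t0 tm _ _ hm1 ai aih.
      by move: ai; rewrite iE /a block_coef_first// th -etaE ltxx eqxx.
    by exists 2, N2; split => //.
  have [|||N2 [sN2 hN2]] := joint_tail_moving_average_shared (T := measurableTypeR R) (P := P) mxi ixi xi_ge0 txi
    a01 aN (h := h.+1) (j0 := (h.+1 * m.*2.+1)%N) eta_gt.
  - by rewrite /a block_coef_first// th eta_gt.
  - by rewrite /a block_coef_second// th eta_gt.
  - by move=> i ai aih; exact: (@block_coef_lag R m t t0 tm _ _ hm1 ai aih).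
  by exists (eta ord0 h)^-1, N2; split => //; [rewrite invrK|rewrite invr_gt0; lra].
split.
  by move=> n tt k B mB; exact: (exp_moving_average_stationary mxi ixi idxi).
exists (@unit_noise _ _ _ P), xi, a; split.
- split; first exact: unit_noise_multiplicative.
  by move=> j w; rewrite mulr1.
- split; [exact: a01|by exists 0%N|].
  (* Any exponent above 1 would do, as the coefficients vanish from [N] on. *)
  exists 2; split; first by rewrite ltr1n.
  apply/eqOP; exists 0; split; first exact: num_real.
  move=> k k0; exists N => // i /= Ni.
  by rewrite aN// normr0 mulr_ge0// ltW.
- split.
  + split; first exact: ixi.
    by move=> j A mA; exact: idxi.
  + rewrite unlock.
    exact: (second_moment_exponential (T := measurableTypeR R) (P := P) (mxi 0) (xi_ge0 0) (txi 0)).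
  (* With [beta = 0] and [K = 1] the tail ratio equals 1 for every [z > 0]. *)
  + exists 0, 1; split => //; first by rewrite eq_sym oppr_eq0 oner_eq0.
    apply: cvg_near_cst; exists 0; split; first exact: num_real.
    move=> z z0.
    have -> : ccdf (xi 0) z = (expR (- z))%:E.
      transitivity (P [set w | z < xi0 0 w]).
        by congr (P _); apply/seteqP; split => w /=; rewrite in_itv /= andbT.
      rewrite txi min_r// -[leRHS]expR0 ler_expR; lra.
    by rewrite /= powRr0 !mul1r divff// gt_eqF// expR_gt0.
- exact: independent_unit_noise.
- split; first by move=> j w; exact: expR_gt0.
  move=> j; apply: aeW => w /=.
  (* The partial sums are constant from [N] on, so the series converges at every point. *)
  rewrite expRK; apply: cvg_near_cst; exists N => // n /= Nn.
  rewrite /series /= /index_iota subn0 -(subnKC Nn) iotaD big_cat /=.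
  rewrite [X in _ + X]big_seq [X in _ + X]big1 ?addr0// => i.
  by rewrite mem_iota add0n => /andP[Ni _]; rewrite aN// mul0r.
Qed.
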